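(* Let $D$ be a database and let $\Sigma$ be a finite set of guarded TGDs. Let $d=|\mathsf{sch}(\Sigma)|\cdot\mathsf{ar}(\Sigma)^{2\cdot\mathsf{ar}(\Sigma)+1}\cdot2^{|\mathsf{sch}(\Sigma)|\cdot\mathsf{ar}(\Sigma)^{\mathsf{ar}(\Sigma)}}$ and $f_{\mathsf{G}}(\Sigma)=(d+1)\cdot\|\Sigma\|^{2\cdot\mathsf{ar}(\Sigma)\cdot(d+1)}$. The following are equivalent: (1) $\Sigma\in\mathsf{CT}_D$, i.e., $\mathsf{chase}(D,\Sigma)$ is finite. (2) $|\mathsf{chase}(D,\Sigma)|\le|D|\cdot f_{\mathsf{G}}(\Sigma)$. (3) $\mathsf{simple}(\mathsf{lin}(\Sigma))$ is $\mathsf{simple}(\mathsf{lin}(D))$-weakly-acyclic.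
   Context: **Basics.** $\mathbf{C},\mathbf{N},\mathbf{V}$ are disjoint countably infinite sets of constants, nulls and variables; their elements are terms. A schema is a finite set of predicates, each with an arity $>0$. An atom is $R(\bar t)$ with $\bar t$ a tuple of terms of length the arity of $R$; a fact is an atom with only constants. An instance is a (possibly infinite) set of atoms over constants and nulls; a database is a finite set of facts; $\mathsf{dom}(\cdot)$ denotes the set of terms occurring in an instance or atom. $|\cdot|$ is cardinality. A homomorphism from a set of atoms $A$ to a set of atoms $B$ maps terms of $A$ to terms of $B$, is the identity on $\mathbf{C}$, and maps atoms of $A$ to atoms of $B$. **TGDs.** A TGD $\sigma$ is a constant-free sentence $\forall\bar x\forall\bar y(\phi(\bar x,\bar y)\to\exists\bar z\,\psi(\bar x,\bar z))$ with $\phi$ (the body) and $\psi$ (the head) non-empty conjunctions of atoms over the variables $\bar x\cup\bar y$ and $\bar x\cup\bar z$; conjunctions are identified with sets of atoms. The frontier $\mathsf{fr}(\sigma)$ is the set of variables $\bar x$ occurring in both body and head. A TGD is guarded if some body atom contains all variables of the body; the leftmost such atom is $\mathsf{guard}(\sigma)$. A TGD is linear if its body is a single atom; it is simple linear if moreover no variable occurs more than once in that atom. For a finite set $\Sigma$ of TGDs (no two sharing a variable, w.l.o.g.), $\mathsf{sch}(\Sigma)$ is the set of predicates occurring in $\Sigma$, $\mathsf{ar}(\Sigma)$ their maximum arity, $\mathsf{atoms}(\Sigma)$ the set of atoms occurring in the TGDs of $\Sigma$, and $\|\Sigma\|=|\mathsf{atoms}(\Sigma)|\cdot|\mathsf{sch}(\Sigma)|\cdot\mathsf{ar}(\Sigma)$.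 **Semi-oblivious chase.** A trigger for $\Sigma$ on an instance $I$ is $(\sigma,h)$ with $\sigma\in\Sigma$ and $h$ a homomorphism from $\mathsf{body}(\sigma)$ to $I$. Its result $\mathsf{result}(\sigma,h)$ is $\mu(\mathsf{head}(\sigma))$, where $\mu(x)=h(x)$ if $x\in\mathsf{fr}(\sigma)$ and otherwise $\mu(x)$ is the null $\bot^x_{\sigma,h_{|\mathsf{fr}(\sigma)}}$, uniquely determined by $x$, $\sigma$ and the restriction of $h$ to $\mathsf{fr}(\sigma)$. The trigger is active if $\mathsf{result}(\sigma,h)\not\subseteq I$; applying it yields $I\cup\mathsf{result}(\sigma,h)$. A valid chase derivation of $D$ w.r.t. $\Sigma$ is a sequence of instances starting with $D$, each next one obtained by applying an active trigger, that is either finite with no active trigger on the last instance, or infinite and fair (every trigger active on some $I_i$ is not active on some later $I_j$). Its result is the union of its instances; all valid derivations have the same result, denoted $\mathsf{chase}(D,\Sigma)$. $\mathsf{CT}_D$ is the class of sets $\Sigma$ of TGDs such that $\mathsf{chase}(D,\Sigma)$ is finite. **Linearization.** Positive integers are treated as constants. For tuples, $\bar t\simeq\bar u$ means they have the same length $n$ and $t_i=t_j$ iff $u_i=u_j$ for all $i,j\in\{1,\ldots,n\}$. For $\alpha\in\mathsf{chase}(D,\Sigma)$, $\mathsf{type}_{D,\Sigma}(\alpha)=\{\beta\in\mathsf{chase}(D,\Sigma)\mid\mathsf{dom}(\beta)\subseteq\mathsf{dom}(\alpha)\}$. $\mathsf{complete}(D,\Sigma)=\{\alpha\in\mathsf{chase}(D,\Sigma)\mid\mathsf{dom}(\alpha)\subseteq\mathsf{dom}(D)\}$.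 A $\Sigma$-type $\tau$ is a pair $(\alpha,T)$ where $\alpha=R(t_1,\ldots,t_n)$ with $R\in\mathsf{sch}(\Sigma)$, the $t_i$ integers with $t_1=1$ and $1\le t_i\le\max_{j<i}t_j+1$ for $i\ge2$, and $T$ is a set of atoms with predicates from $\mathsf{sch}(\Sigma)$ and terms from $\mathsf{dom}(\alpha)$, with $\alpha\notin T$. Put $\mathsf{guard}(\tau)=\alpha$ and $\mathsf{atoms}(\tau)=T\cup\{\alpha\}$. For $\bar u\simeq(t_1,\ldots,t_n)$, $\tau(\bar u)$ is obtained from $\mathsf{atoms}(\tau)$ by replacing each $t_i$ with $u_i$. For each $\Sigma$-type $\tau$, $[\tau]$ is a new predicate with the arity of the predicate of $\mathsf{guard}(\tau)$. *Database:* $\mathsf{lin}(D)$ (which depends also on $\Sigma$) is the set of all $[\tau](\bar t)$ such that $R(\bar t)\in D$, $\tau$ is a $\Sigma$-type with $\mathsf{guard}(\tau)=R(\bar u)$ for some $\bar u\simeq\bar t$, and $\tau(\bar t)=\mathsf{type}_{D,\Sigma}(R(\bar t))$. *TGDs:* Let $\sigma\in\Sigma$ be $\varphi(\bar x,\bar y)\to\exists z_1\cdots\exists z_n\,R_1(\bar u_1),\ldots,R_m(\bar u_m)$ with $\mathsf{guard}(\sigma)=R(\bar u)$ and frontier $\bar x$. Let $\tau$ be a $\Sigma$-type and $h$ a homomorphism from $\varphi(\bar x,\bar y)$ to $\mathsf{atoms}(\tau)$ with $h(R(\bar u))=\mathsf{guard}(\tau)$. The linearization of $\sigma$ induced by $\tau$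 and $h$ is the linear TGD $[\tau](\bar u)\to\exists z_1\cdots\exists z_n\,[\tau_1](\bar u_1),\ldots,[\tau_m](\bar u_m)$, where the $\tau_i$ are as follows. Let $f(t)=h(t)$ for $t\in\bar x$ and $f(z_i)=\mathsf{ar}(\Sigma)+i$; let $\alpha_i=R_i(f(\bar u_i))$, $I=\{\alpha_1,\ldots,\alpha_m\}\cup\mathsf{atoms}(\tau)$, and $T_i=\{\beta\in\mathsf{complete}(I,\Sigma)\mid\mathsf{dom}(\beta)\subseteq\mathsf{dom}(\alpha_i)\}\setminus\{\alpha_i\}$. Let $\rho$ rename the integers of $\alpha_i$ by order of first occurrence in $\alpha_i$, starting from $1$ (e.g. $R(2,2,4,1)$ becomes $R(1,1,2,3)$); then $\tau_i=(\rho(\alpha_i),\rho(T_i))$. $\mathsf{lin}(\sigma)$ is the set of all linearizations of $\sigma$ over all such $\tau,h$, and $\mathsf{lin}(\Sigma)=\bigcup_{\sigma\in\Sigma}\mathsf{lin}(\sigma)$. **Simplification.** For a tuple of terms $\bar t=(t_1,\ldots,t_n)$, $\mathsf{unique}(\bar t)$ is obtained by keeping only the first occurrence of each term; $\mathsf{id}_{\bar t}(t_i)$ is the position of $t_i$ in $\mathsf{unique}(\bar t)$, and $\mathsf{id}(\bar t)=(\mathsf{id}_{\bar t}(t_1),\ldots,\mathsf{id}_{\bar t}(t_n))$. The simplification of an atom $R(\bar t)$ is $\mathsf{simple}(R(\bar t))=R_{\mathsf{id}(\bar t)}(\mathsf{unique}(\bar t))$, where each $R_{\mathsf{id}(\bar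 t)}$ is a new predicate; the simplification of a set (or conjunction) of atoms is taken atomwise. A specialization of a tuple of variables $\bar x=(x_1,\ldots,x_n)$ is a function $f$ from the variables of $\bar x$ to the variables of $\bar x$ with $f(x_1)=x_1$ and $f(x_i)\in\{f(x_1),\ldots,f(x_{i-1}),x_i\}$ for $2\le i\le n$. For a linear TGD $\sigma=R(\bar x)\to\exists\bar z\,\psi(\bar y,\bar z)$ with $\bar y\subseteq\bar x$, $\mathsf{simple}(\sigma)$ is the set of all simple linear TGDs $\mathsf{simple}(R(f(\bar x)))\to\exists\bar z\,\mathsf{simple}(\psi(f(\bar y),\bar z))$ with $f$ a specialization of $\bar x$; for a set $\Sigma'$ of linear TGDs, $\mathsf{simple}(\Sigma')=\bigcup_{\sigma\in\Sigma'}\mathsf{simple}(\sigma)$. **Non-uniform weak-acyclicity** (for a set $\Sigma$ of TGDs and a database $D$). The dependency graph $\mathsf{dg}(\Sigma)$ is the directed multigraph whose nodes are the positions $(R,i)$ with $R\in\mathsf{sch}(\Sigma)$, $1\le i\le$ arity of $R$, and whose edges are exactly: for each $\sigma\in\Sigma$, each $x\in\mathsf{fr}(\sigma)$ and each position $\pi$ at which $x$ occurs in $\mathsf{body}(\sigma)$, a normal edge from $\pi$ to each position at which $x$ occurs in an atom of $\mathsf{head}(\sigma)$, and a special edge from $\pi$ to each position at which an existentially quantified variable of $\sigma$ occurs in an atom of $\mathsf{head}(\sigma)$. For $R,P\in\mathsf{sch}(\Sigma)$ write $R\to_\Sigma P$ if $R=P$ or some $\sigma\in\Sigma$ has $R$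 in its body and $P$ in its head; $\rightsquigarrow_\Sigma$ is the transitive closure of $\to_\Sigma$. A (not necessarily simple, possibly cyclic) path in $\mathsf{dg}(\Sigma)$ is $D$-supported if there are $R(\bar t)\in D$ and a node $(P,i)$ on the path with $R\rightsquigarrow_\Sigma P$. $\Sigma$ is $D$-weakly-acyclic if $\mathsf{dg}(\Sigma)$ has no $D$-supported cycle containing a special edge.
   Formalization: In lin(D), the condition τ(t)=type(R(t)) is compared only on atoms with predicates in sch(Σ); read literally the claim fails when D has other predicates, e.g. Σ={R(x,y)→∃z R(y,z)}, D={R(a,b),Q(a)}. Nothing changes when D is over sch(Σ). *)

(* Defs.v *)
From HB Require Import structures.
From mathcomp Require Import all_boot finmap all_classical.
From Stdlib Require Import Relation_Operators.

Set Implicit Arguments.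
Unset Strict Implicit.
Unset Printing Implicit Defensive.

Local Open Scope classical_set_scope.

(* Constants and variables are two copies of nat, kept apart by the types in
   which they are used.  In particular positive integers are constants. *)
Definition const := nat.
Definition var := nat.

Definition atom (P T : Type) := (P * seq T)%type.
Definition fact (P : Type) := atom P const.

(* (body, head); the head variables that are not in the body are the
   existentially quantified ones.  Lists, because the guard is the leftmost
   suitable body atom. *)
Definition tgd (P : Type) := (seq (atom P var) * seq (atom P var))%type.

(* Terms of an instance.  [Null s x us] is the null determined by the variable
   x, the TGD s and the restriction of h to the frontier of s, the latter being
   given by its list of values us = [seq h y | y <- fr s]. *)
Inductive term (P : Type) :=
| Const of const
| Null of tgd P & var & seq (term P).
Arguments Const {P}.

HB.instance Definition _ (P : Type) := gen_eqMixin (term P).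
HB.instance Definition _ (P : Type) := gen_choiceMixin (term P).

Definition instance (P : Type) := set (atom P (term P)).

Definition map_atom (P T U : Type) (f : T -> U) (a : atom P T) : atom P U :=
  (a.1, [seq f t | t <- a.2]).

Definition ground (P : Type) (a : fact P) : atom P (term P) :=
  map_atom Const a.

Definition inst_of (P : Type) (D : set (fact P)) : instance P :=
  [set ground a | a in D].

Definition dom (P : Type) (T : eqType) (a : atom P T) : set T := [set` a.2].

Definition idom (P : Type) (I : instance P) : set (term P) :=
  \bigcup_(a in I) dom a.

Definition ncard (T : choiceType) (A : set T) : nat := #|` fset_set A|%fset.

Definition wf_atom (P T : Type) (ar : P -> nat) (a : atom P T) : Prop :=
  size a.2 = ar a.1.

Definition database (P : choiceType) (ar : P -> nat) (D : set (fact P)) :=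
  finite_set D /\ forall a, D a -> wf_atom ar a.

Definition vars (P : Type) (A : seq (atom P var)) : seq var :=
  flatten [seq a.2 | a <- A].

Definition tgd_body (P : Type) (s : tgd P) := s.1.
Definition tgd_head (P : Type) (s : tgd P) := s.2.

Definition tgd_atoms (P : Type) (s : tgd P) := tgd_body s ++ tgd_head s.

Definition fr (P : Type) (s : tgd P) : seq var :=
  [seq x <- undup (vars (tgd_body s)) | x \in vars (tgd_head s)].

Definition exvars (P : Type) (s : tgd P) : seq var :=
  [seq x <- undup (vars (tgd_head s)) | x \notin vars (tgd_body s)].

Definition guards (P : Type) (s : tgd P) (a : atom P var) : bool :=
  all (fun x => x \in a.2) (vars (tgd_body s)).

Definition guarded (P : Type) (s : tgd P) : bool := has (guards s) (tgd_body s).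

Definition guard (P : Type) (s : tgd P) : option (atom P var) :=
  ohead [seq a <- tgd_body s | guards s a].

Definition wf_tgd (P : choiceType) (ar : P -> nat) (s : tgd P) : Prop :=
  [/\ tgd_body s <> [::], tgd_head s <> [::] &
      forall a, a \in tgd_atoms s -> wf_atom ar a].

Definition tgd_set (P : choiceType) (ar : P -> nat) (S : set (tgd P)) : Prop :=
  [/\ finite_set S, forall s, S s -> wf_tgd ar s &
      forall s s' x, S s -> S s' -> x \in vars (tgd_atoms s) ->
        x \in vars (tgd_atoms s') -> s = s'].

Definition atoms (P : choiceType) (S : set (tgd P)) : set (atom P var) :=
  \bigcup_(s in S) [set` tgd_atoms s].

Definition sch (P : choiceType) (S : set (tgd P)) : set P :=
  [set a.1 | a in atoms S].

Definition max_ar (P : choiceType) (ar : P -> nat) (S : set (tgd P)) : nat :=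
  \max_(p <- fset_set (sch S)) ar p.

Definition tnorm (P : choiceType) (ar : P -> nat) (S : set (tgd P)) : nat :=
  ncard (atoms S) * ncard (sch S) * max_ar ar S.

Definition hom (P : choiceType) (T : Type) (A : seq (atom P var))
    (B : set (atom P T)) (h : var -> T) : Prop :=
  forall a, a \in A -> B (map_atom h a).

Definition trigger (P : choiceType) (S : set (tgd P)) (I : instance P)
    (s : tgd P) (h : var -> term P) : Prop :=
  S s /\ hom (tgd_body s) I h.

Definition trigger_subst (P : choiceType) (s : tgd P) (h : var -> term P)
    (x : var) : term P :=
  if x \in fr s then h x else Null s x [seq h y | y <- fr s].

Definition result (P : choiceType) (s : tgd P) (h : var -> term P) :
    instance P :=
  [set map_atom (trigger_subst s h) a | a in [set` tgd_head s]].

Definition active (P : choiceType) (S : set (tgd P)) (I : instance P)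
    (s : tgd P) (h : var -> term P) : Prop :=
  trigger S I s h /\ ~ (result s h `<=` I).

Definition chase_step (P : choiceType) (S : set (tgd P)) (I J : instance P) :=
  exists s h, active S I s h /\ J = I `|` result s h.

Definition finite_derivation (P : choiceType) (I : instance P)
    (S : set (tgd P)) (n : nat) (Is : nat -> instance P) : Prop :=
  [/\ Is 0 = I, forall i, i < n -> chase_step S (Is i) (Is i.+1) &
      forall s h, ~ active S (Is n) s h].

Definition infinite_derivation (P : choiceType) (I : instance P)
    (S : set (tgd P)) (Is : nat -> instance P) : Prop :=
  [/\ Is 0 = I, forall i, chase_step S (Is i) (Is i.+1) &
      forall i s h, active S (Is i) s h ->
        exists2 j, i < j & ~ active S (Is j) s h].

Definition derivation_result (P : choiceType) (I : instance P)
    (S : set (tgd P)) (J : instance P) : Prop :=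
  (exists n Is, finite_derivation I S n Is /\
     J = \bigcup_(i in [set i | i <= n]) Is i) \/
  (exists Is, infinite_derivation I S Is /\ J = \bigcup_i Is i).

(* All valid derivations have the same result, so that the union below is over
   a single instance. *)
Definition chase_inst (P : choiceType) (I : instance P) (S : set (tgd P)) :
    instance P :=
  \bigcup_(J in derivation_result I S) J.

Definition chase (P : choiceType) (D : set (fact P)) (S : set (tgd P)) :
    instance P :=
  chase_inst (inst_of D) S.

Definition CT (P : choiceType) (D : set (fact P)) : set (set (tgd P)) :=
  [set S | finite_set (chase D S)].

Definition same_pattern (T U : eqType) (t : seq T) (u : seq U) : Prop :=
  size t = size u /\
  forall i j, i < size t -> j < size t ->
    (onth t i = onth t j <-> onth u i = onth u j).

Definition type_of (P : choiceType) (D : set (fact P)) (S : set (tgd P))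
    (a : atom P (term P)) : instance P :=
  [set b | chase D S b /\ dom b `<=` dom a].

Definition complete (P : choiceType) (D : set (fact P)) (S : set (tgd P)) :
    instance P :=
  [set a | chase D S a /\ dom a `<=` idom (inst_of D)].

(* (guard, other atoms).  A pair tau also serves as the new predicate [tau]. *)
Definition stype (P : Type) := (fact P * set (fact P))%type.

Definition tguard (P : Type) (tau : stype P) : fact P := tau.1.
Definition tatoms (P : Type) (tau : stype P) : set (fact P) :=
  tau.2 `|` [set tau.1].

Definition is_stype (P : choiceType) (ar : P -> nat) (S : set (tgd P))
    (tau : stype P) : Prop :=
  let: (a, T) := tau in
  let t := nth 0 a.2 in
  [/\ sch S a.1 /\ wf_atom ar a,
      t 0 = 1,
      forall i, 0 < i < size a.2 -> 1 <= t i <= (\max_(j < i) t j).+1,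
      forall b, T b -> [/\ sch S b.1, wf_atom ar b & dom b `<=` dom a] &
      ~ T a].

Definition replace (t u : seq const) (c : const) : const :=
  nth c u (index c t).

Definition tinst (P : Type) (tau : stype P) (u : seq const) : set (fact P) :=
  [set map_atom (replace (tguard tau).2 u) b | b in tatoms tau].

(* A Sigma-type has atoms over sch(Sigma) only.  The type of a database atom is
   therefore compared with it on the predicates of sch(Sigma).  This has no
   effect when all predicates of D are in sch(Sigma); otherwise it forbids a
   fact such as Q(a), with Q foreign to Sigma, to remove R(a) from lin(D). *)
Definition lin_db (P : choiceType) (ar : P -> nat) (D : set (fact P))
    (S : set (tgd P)) : set (fact (stype P)) :=
  [set b | exists R t tau, [/\ b = (tau, t), D (R, t), is_stype ar S tau,
     (tguard tau).1 = R /\ same_pattern (tguard tau).2 t &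
     inst_of (tinst tau t) =
       type_of D S (ground (R, t)) `&` [set c | sch S c.1]]].

(* [undup] keeps last occurrences, hence the reversals. *)
Definition unique_tuple (T : eqType) (t : seq T) : seq T := rev (undup (rev t)).

Definition idx (T : eqType) (t : seq T) (c : T) : nat :=
  (index c (unique_tuple t)).+1.

Definition id_tuple (T : eqType) (t : seq T) : seq nat :=
  [seq idx t c | c <- t].

Definition lin_map (P : choiceType) (ar : P -> nat) (S : set (tgd P))
    (s : tgd P) (h : var -> const) (x : var) : const :=
  if x \in fr s then h x else max_ar ar S + (index x (exvars s)).+1.

Definition lin_inst (P : choiceType) (ar : P -> nat) (S : set (tgd P))
    (s : tgd P) (tau : stype P) (h : var -> const) : set (fact P) :=
  [set map_atom (lin_map ar S s h) a | a in [set` tgd_head s]] `|` tatoms tau.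

Definition head_type (P : choiceType) (ar : P -> nat) (S : set (tgd P))
    (s : tgd P) (tau : stype P) (h : var -> const) (a : atom P var) :
    stype P :=
  let alpha := map_atom (lin_map ar S s h) a in
  let T := [set b : fact P | complete (lin_inst ar S s tau h) S (ground b) /\
                             dom b `<=` dom alpha] `\ alpha in
  let rho := map_atom (idx alpha.2) in
  (rho alpha, [set rho b | b in T]).

Definition lin_tgd (P : choiceType) (ar : P -> nat) (S : set (tgd P))
    (s : tgd P) : set (tgd (stype P)) :=
  [set s' | exists g tau h,
    [/\ guard s = Some g, is_stype ar S tau, hom (tgd_body s) (tatoms tau) h,
        map_atom h g = tguard tau &
        s' = ([:: (tau, g.2)],
              [seq (head_type ar S s tau h a, a.2) | a <- tgd_head s])]].

Definition lin (P : choiceType) (ar : P -> nat) (S : set (tgd P)) :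
    set (tgd (stype P)) :=
  \bigcup_(s in S) lin_tgd ar S s.

(* R_id is the pair (R, id). *)
Definition spred (Q : Type) := (Q * seq nat)%type.

(* R_(id(t)) takes the tuple unique(t), whose length is the largest entry of
   id(t). *)
Definition spred_ar (Q : Type) (p : spred Q) : nat := \max_(i <- p.2) i.

Definition simple_atom (Q : Type) (T : eqType) (a : atom Q T) :
    atom (spred Q) T :=
  ((a.1, id_tuple a.2), unique_tuple a.2).

Definition specialization (xs : seq var) (f : var -> var) : Prop :=
  forall i, i < size xs ->
    let x := nth 0 xs i in f x \in rcons [seq f y | y <- take i xs] x.

Definition simple_tgd (Q : Type) (s : tgd Q) : set (tgd (spred Q)) :=
  [set s' | exists b f, [/\ tgd_body s = [:: b], specialization b.2 f &
     s' = ([:: simple_atom (map_atom f b)],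
           [seq simple_atom (map_atom (fun x => if x \in b.2 then f x else x) a)
             | a <- tgd_head s])]].

Definition simple (Q : Type) (S : set (tgd Q)) : set (tgd (spred Q)) :=
  \bigcup_(s in S) simple_tgd s.

Definition simple_db (Q : Type) (D : set (fact Q)) : set (fact (spred Q)) :=
  [set simple_atom a | a in D].

(* Positions are numbered from 1. *)
Definition position (Q : Type) := (Q * nat)%type.

Definition dg_node (Q : choiceType) (ar : Q -> nat) (S : set (tgd Q))
    (p : position Q) : Prop :=
  sch S p.1 /\ 1 <= p.2 <= ar p.1.

Definition occurs_at (Q : choiceType) (x : var) (A : seq (atom Q var))
    (p : position Q) : Prop :=
  exists a, [/\ a \in A, a.1 = p.1, 0 < p.2 & onth a.2 p.2.-1 = Some x].

(* The boolean marks special edges.  Edges that differ only in the TGD they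
   come from are not distinguished. *)
Definition dg_edge (Q : choiceType) (ar : Q -> nat) (S : set (tgd Q))
    (p : position Q) (special : bool) (q : position Q) : Prop :=
  [/\ dg_node ar S p, dg_node ar S q &
      exists s x, [/\ S s, x \in fr s, occurs_at x (tgd_body s) p &
        if special then exists2 z, z \in exvars s & occurs_at z (tgd_head s) q
        else occurs_at x (tgd_head s) q]].

Fixpoint dg_path (Q : choiceType) (ar : Q -> nat) (S : set (tgd Q))
    (p : position Q) (w : seq (bool * position Q)) : Prop :=
  if w is (b, q) :: w' then dg_edge ar S p b q /\ dg_path ar S q w' else True.

Definition path_nodes (Q : Type) (p : position Q)
    (w : seq (bool * position Q)) : seq (position Q) :=
  p :: [seq e.2 | e <- w].

Definition pred_step (Q : choiceType) (S : set (tgd Q)) (R P : Q) : Prop :=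
  [/\ sch S R, sch S P &
      R = P \/ exists s, [/\ S s, R \in [seq a.1 | a <- tgd_body s] &
                             P \in [seq a.1 | a <- tgd_head s]]].

Definition pred_reach (Q : choiceType) (S : set (tgd Q)) : Q -> Q -> Prop :=
  clos_trans Q (pred_step S).

Definition supported (Q : choiceType) (S : set (tgd Q)) (D : set (fact Q))
    (p : position Q) (w : seq (bool * position Q)) : Prop :=
  exists a n, [/\ D a, n \in path_nodes p w & pred_reach S a.1 n.1].

Definition weakly_acyclic (Q : choiceType) (ar : Q -> nat) (D : set (fact Q))
    (S : set (tgd Q)) : Prop :=
  ~ exists p w, [/\ dg_path ar S p w, last p [seq e.2 | e <- w] = p,
      true \in [seq e.1 | e <- w] & supported S D p w].

Definition depth_bound (P : choiceType) (ar : P -> nat) (S : set (tgd P)) :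
    nat :=
  let n := ncard (sch S) in
  let m := max_ar ar S in
  n * m ^ (2 * m + 1) * 2 ^ (n * m ^ m).

Definition fG (P : choiceType) (ar : P -> nat) (S : set (tgd P)) : nat :=
  let d := depth_bound ar S in
  (d + 1) * tnorm ar S ^ (2 * max_ar ar S * (d + 1)).

(* Main.v *)
Require Import Defs.
From mathcomp Require Import all_boot finmap all_classical.
From Stdlib Require Import Relation_Operators.

(* Every chase atom has a Sigma-type, and in the chase of guarded TGDs the types
   of the head atoms of a trigger depend only on the type of its guard.  Hence
   the triggers of the chase correspond to the TGDs of simple(lin(Sigma)) whose
   body predicate is the type of a chase atom, and their dependency edges follow
   single terms of the chase, a special edge leading to a deeper term.
   A supported cycle with a special edge can therefore be followed for ever from
   some chase atom, which yields terms of unbounded depth.  Without such a cycle,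
   a term of depth n provides n distinct positions, so that n is at most the
   number of positions; and only boundedly many atoms have bounded depth, because
   the terms of an atom come from a single fact of D or a single trigger. *)

Set Implicit Arguments.
Unset Strict Implicit.
Unset Printing Implicit Defensive.

Local Open Scope classical_set_scope.
Local Open Scope card_scope.

(** [lin(Sigma)] contains TGDs for all Sigma-types, also for those of no chase atom, so the
    dependency graph has edges that are unrelated to the chase. Support overcomes this: predicates
    of [simple(lin(D))] belong to chase atoms, and a TGD whose body predicate belongs to a chase
    atom comes from an actual trigger, so every predicate reachable from them again belongs to a
    chase atom. The chase of the simplified linear TGDs is therefore never built; positions of the
    graph are compared directly with terms of [chase(D, Sigma)]. The delicate point is that a head
    type is defined through the chase of a small instance over integers. This small chase must miss
    no atom of the full chase over the terms of the head atom, although the full chase has many more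
    atoms to derive from; that rests on guardedness. *)

Lemma term_ind_in (P : Type) (Q : term P -> Prop) :
  (forall c, Q (Const c)) ->
  (forall s x us, (forall u, u \in us -> Q u) -> Q (Null s x us)) ->
  forall t, Q t.
Proof.
move=> Qc Qn; fix IH 1 => -[c|s x us]; first exact: Qc.
apply: Qn; elim: us => [|v us IHus] u; first by clear IH; rewrite in_nil.
by rewrite in_cons => /predU1P[-> //|/IHus].
Qed.

(** * Depth of terms; variables and renamed atoms *)

Fixpoint depth (P : Type) (t : term P) : nat :=
  if t is Null _ _ us then (\max_(n <- [seq depth u | u <- us]) n).+1 else 0.

Lemma leq_depth_args (P : Type) (us : seq (term P)) (u : term P) :
  u \in us -> depth u <= \max_(n <- [seq depth u | u <- us]) n.
Proof. by move=> uus; rewrite big_map; apply: leq_bigmax_seq. Qed.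

Lemma depth_Null_gt (P : Type) (s : tgd P) x us (u : term P) :
  u \in us -> depth u < depth (Null s x us).
Proof. exact: leq_depth_args. Qed.

Lemma depth_argsP (P : Type) (us : seq (term P)) :
  us = [::] \/ exists2 u, u \in us &
    depth u = \max_(n <- [seq depth u | u <- us]) n.
Proof.
elim: us => [|v us IH]; [by left|right]; rewrite /= big_cons.
case: IH => [->|[u uus du]].
  by exists v; rewrite ?mem_head // big_nil maxn0.
case: (leqP (depth v) (depth u)) => h.
  by exists u; rewrite ?in_cons ?uus ?orbT // -du; apply/esym/maxn_idPr.
by exists v; rewrite ?mem_head // -du; apply/esym/maxn_idPl/ltnW.
Qed.

Lemma mem_vars (P : choiceType) (A : seq (atom P var)) (a : atom P var) x :
  a \in A -> x \in a.2 -> x \in vars A.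
Proof. by move=> aA xa; apply/flattenP; exists a.2 => //; exact: map_f. Qed.

Lemma varsP (P : choiceType) (A : seq (atom P var)) x :
  reflect (exists2 a, a \in A & x \in a.2) (x \in vars A).
Proof.
apply: (iffP flattenP) => [[_ /mapP[a aA ->] xa]|[a aA xa]]; first by exists a.
by exists a.2 => //; exact: map_f.
Qed.

Lemma mem_fr (P : Type) (s : tgd P) x :
  (x \in fr s) = (x \in vars (tgd_body s)) && (x \in vars (tgd_head s)).
Proof. by rewrite mem_filter mem_undup andbC. Qed.

Lemma mem_exvars (P : Type) (s : tgd P) x :
  (x \in exvars s) = (x \notin vars (tgd_body s)) && (x \in vars (tgd_head s)).
Proof. by rewrite mem_filter mem_undup. Qed.

Lemma map_atom_eq (P : Type) (T : eqType) (U : Type) (f g : T -> U)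
    (a : atom P T) :
  {in a.2, f =1 g} -> map_atom f a = map_atom g a.
Proof. by move=> fg; congr pair; apply/eq_in_map. Qed.

Lemma map_atom_comp (P T U V : Type) (f : U -> V) (g : T -> U) (a : atom P T) :
  map_atom f (map_atom g a) = map_atom (f \o g) a.
Proof. by rewrite /map_atom /= -map_comp. Qed.

(** * Existence of fair derivations *)

Section Chase.
Variables (P : choiceType) (S : set (tgd P)).
Implicit Types (I J : instance P) (s : tgd P) (h : var -> term P).

(** Closure under all triggers, active or not, in no particular order: later proofs are inductions
    on it and never mention derivations. *)
Inductive least_chase I : atom P (term P) -> Prop :=
| Chase_base a : I a -> least_chase I a
| Chase_step s h a : S s ->
    (forall b, b \in tgd_body s -> least_chase I (map_atom h b)) ->
    a \in tgd_head s -> least_chase I (map_atom (trigger_subst s h) a).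

Lemma chase_step_sub I J : chase_step S I J -> I `<=` J.
Proof. by case=> s [h [_ ->]]; exact: subsetUl. Qed.

Lemma chase_step_least I0 I J : chase_step S I J ->
  I `<=` least_chase I0 -> J `<=` least_chase I0.
Proof.
move=> [s [h [[[Ss hI] _] ->]]] IC b [/IC //|[a /= ah <-]].
by apply: Chase_step => // c cb; apply/IC/hI.
Qed.

(** A finite derivation ends in an instance closed under triggers. In an infinite one the finite
    body of a trigger is present from some stage on, and fairness supplies the result. *)
Lemma derivation_result_least I J :
  derivation_result I S J -> J = least_chase I.
Proof.
have least_sub (Is : nat -> instance P) (n : nat) : Is 0 = I ->
    (forall i, i < n -> chase_step S (Is i) (Is i.+1)) ->
    Is n `<=` least_chase I.
  move=> I0; elim: n => [|n IH] st; first by rewrite I0 => a; exact: Chase_base.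
  by apply: (chase_step_least (st n _)) => //; apply: IH => i /ltnW; exact: st.
have mono (Is : nat -> instance P) (n i j : nat) :
    (forall i, i < n -> chase_step S (Is i) (Is i.+1)) ->
    i <= j -> j <= n -> Is i `<=` Is j.
  move=> st; elim: j => [|j IH]; first by rewrite leqn0 => /eqP-> _ a.
  rewrite leq_eqVlt ltnS => /predU1P[-> _ a|ij jn] //.
  exact: (subset_trans (IH ij (ltnW jn)) (chase_step_sub (st _ jn))).
have max_stage (Is : nat -> instance P) s h (n : nat) :
    (forall i j, i <= j -> j <= n -> Is i `<=` Is j) ->
    (forall b, b \in tgd_body s -> exists2 i, i <= n & Is i (map_atom h b)) ->
    exists2 i, i <= n & hom (tgd_body s) (Is i) h.
  move=> mon; rewrite /hom; elim: (tgd_body s) => [|b bs IH] ex;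
    first by exists 0.
  have [i ile hi] := ex b (mem_head _ _).
  have [j jle hj] := IH (fun c cb => ex c (@mem_behead _ (b :: bs) c cb)).
  exists (maxn i j); first by rewrite geq_max ile.
  have le_n : maxn i j <= n by rewrite geq_max ile.
  move=> c; rewrite in_cons => /predU1P[->|/hj].
    by apply: (mon i) => //; exact: leq_maxl.
  by apply: mon => //; exact: leq_maxr.
move=> [[n [Is [[I0 st fin] ->]]]|[Is [[I0 st fair] ->]]];
  apply/seteqP; split=> a.
- by move=> [i /= ile]; apply: (least_sub Is) => // j ji;
    exact: (st _ (leq_trans ji ile)).
- elim=> {a} [a Ia|s h a Ss _ IH ah]; first by exists 0; rewrite ?I0.
  have bn : hom (tgd_body s) (Is n) h.
    by move=> b /IH[i /= ile]; exact: (mono Is n).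
  exists n; first exact: leqnn.
  apply: contrapT => na; apply: (fin s h); split=> // sub.
  by apply: na; apply: sub; exists a.
- by move=> [i _]; apply: (least_sub Is) => // j _; exact: st.
- elim=> {a} [a Ia|s h a Ss _ IH ah]; first by exists 0; rewrite ?I0.
  have monI i j : i <= j -> Is i `<=` Is j by move=> ij; exact: (mono Is j).
  have [i bi] : exists i, hom (tgd_body s) (Is i) h.
    rewrite /hom; elim: (tgd_body s) IH => [|b bs IHb] IH; first by exists 0.
    have [i _ hi] := IH b (mem_head _ _).
    have [j hj] := IHb (fun c cb => IH c (@mem_behead _ (b :: bs) c cb)).
    exists (maxn i j) => c; rewrite in_cons => /predU1P[->|/hj].
      by apply: monI hi; exact: leq_maxl.
    by apply: monI; exact: leq_maxr.
  (* The body stays in all later instances, so the only way for the trigger to be inactive is that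
     its result is contained in the instance. *)
  case: (pselect (active S (Is i) s h)) => [/fair[j ij nact]|nact].
    exists j => //; apply: contrapT => na; apply: nact; split.
      by split=> // b /bi; apply: monI; exact: ltnW.
    by move=> sub; apply: na; apply: sub; exists a.
  exists i => //; apply: contrapT => na; apply: nact; split=> // sub.
  by apply: na; apply: sub; exists a.
Qed.

(** Terms over an arbitrary [P] need not be countable, but those over a finite list of TGDs are:
    each TGD is encoded by its index in the list. This provides the ranks of triggers. *)
Fixpoint encode_term (e : seq (tgd P)) (t : term P) : GenTree.tree nat :=
  match t with
  | Const c => GenTree.Leaf c
  | Null s x us => GenTree.Node (index s e) (GenTree.Leaf x :: map (encode_term
    e) us)
  end.

Fixpoint over_tgds (e : seq (tgd P)) (t : term P) : bool :=
  if t is Null s _ us then (s \in e) && all (over_tgds e) us else true.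

Lemma encode_term_inj (e : seq (tgd P)) : {in over_tgds e &, injective
  (encode_term e)}.
Proof.
move=> t; elim/term_ind_in: t => [c|s x us IH] [c'|s' x' us'] //=.
  by move=> _ _ [->].
rewrite !unfold_in /= => /andP[se ok] /andP[se' ok'] [es -> eu].
congr Null; first by rewrite -(nth_index s se) es nth_index.
elim: us us' IH ok ok' eu {es} => [|u us IHu] [|u' us'] //= IH.
move=> /andP[ou ok] /andP[ou' ok'] [/IH -> //]; last exact: mem_head.
by move/IHu => -> // v vus; apply: IH; rewrite in_cons vus orbT.
Qed.

Lemma chase_over_tgds (e : seq (tgd P)) I a :
  (forall s, S s -> s \in e) ->
  (forall b, I b -> all (over_tgds e) b.2) ->
  least_chase I a -> all (over_tgds e) a.2.
Proof.
move=> Se okI; elim=> {a} [//|s h a Ss _ IH ah].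
have okh x : x \in fr s -> over_tgds e (h x).
  rewrite mem_fr => /andP[/varsP[b bb xb] _].
  by have /allP := IH b bb; apply; exact: map_f.
apply/allP => _ /mapP[x xa ->]; rewrite /trigger_subst;
  case: ifP => [/okh //|_].
by rewrite /= Se //; apply/allP => _ /mapP[y /okh oky ->].
Qed.

Lemma eq_result s h h' :
  [seq h y | y <- fr s] = [seq h' y | y <- fr s] -> result s h = result s h'.
Proof.
move=> hh'; have hh'_in : {in fr s, h =1 h'} by apply/eq_in_map.
by rewrite /result; apply/eq_imagel => a _; apply: map_atom_eq => x _;
  rewrite /trigger_subst hh'; case: ifP => // /hh'_in.
Qed.

(* Always applying an active trigger of least rank is fair, because a trigger is
   active at most until it is applied and ranks are injective on results. *)
Lemma exists_derivation I (rank : tgd P -> (var -> term P) -> nat) :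
  (forall s h s' h', trigger S (least_chase I) s h ->
     trigger S (least_chase I) s' h' -> rank s h = rank s' h' ->
     result s h = result s' h') ->
  exists J, derivation_result I S J.
Proof.
move=> rank_inj.
pose least J s h := active S J s h /\
  forall s' h', active S J s' h' -> rank s h <= rank s' h'.
pose next_of J J' := exists s h, least J s h /\ J' = J `|` result s h.
pose next J := if pselect (exists J', next_of J J') is left ex
               then projT1 (cid ex) else J.
have nextP J s h : active S J s h -> next_of J (next J).
  move=> act; rewrite /next; case: pselect => [ex|[]];
    first exact: (projT2 (cid ex)).
  have ex : exists n, `[< exists s h, active S J s h /\ rank s h = n >].
    by exists (rank s h); apply/asboolP; exists s, h.
  have [n /asboolP[s1 [h1 [act1 <-]]] min] := ex_minnP ex.
  exists (J `|` result s1 h1), s1, h1; split=> //; split=> // s' h' act'.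
  by apply: min; apply/asboolP; exists s', h'.
pose Is n := iter n next I.
case: (pselect (exists n, forall s h, ~ active S (Is n) s h)) => [ex|nex].
  have ex' : exists n, `[< forall s h, ~ active S (Is n) s h >].
    by case: ex => n ?; exists n; apply/asboolP.
  have [n /asboolP stop min] := ex_minnP ex'.
  eexists; left; exists n, Is; split=> //; split=> // i lt_in.
  have /existsNP[s /existsNP[h /contrapT act]] :
      ~ forall s h, ~ active S (Is i) s h.
    by move=> /asboolP/min; rewrite leqNgt lt_in.
  by have [s' [h' [[act' _] E]]] := nextP _ _ _ act; exists s', h'.
have act i : exists s h, active S (Is i) s h.
  apply: contrapT => na; apply: nex; exists i => s h ?.
  by apply: na; exists s, h.
have step i : exists s h, least (Is i) s h /\ Is i.+1 = Is i `|` result s h.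
  by have [s [h /nextP]] := act i.
have chase i : chase_step S (Is i) (Is i.+1).
  by have [s [h [[? _] ?]]] := step i; exists s, h.
have mono i j : i <= j -> Is i `<=` Is j.
  move=> /subnK <-; elim: (j - i) => [//|k IH] a /IH.
  exact: (chase_step_sub (chase _)).
have sub_least i : Is i `<=` least_chase I.
  elim: i => [a|i IH]; first exact: Chase_base.
  exact: (chase_step_least (chase i)).
eexists; right; exists Is; split=> //; split=> // i s h act_i;
  apply: contrapT => no.
have act_j j : i <= j -> active S (Is j) s h.
  rewrite leq_eqVlt => /predU1P[<- //|ij].
  by apply: contrapT => na; apply: no; exists j.
have /choice[r rP] : forall j, exists n, exists s h,
    [/\ least (Is j) s h, Is j.+1 = Is j `|` result s h & n = rank s h].
  by move=> j; have [s1 [h1 [? ?]]] := step j; exists (rank s1 h1), s1, h1.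
have trig j s1 h1 : active S (Is j) s1 h1 -> trigger S (least_chase I) s1 h1.
  by move=> [[? hb] _]; split=> // b /hb; exact: sub_least.
have r_neq j k : j < k -> r j <> r k.
  move=> jk; have [s1 [h1 [[a1 _] e1 ->]]] := rP j.
  have [s2 [h2 [[a2 _] _ ->]]] := rP k.
  move=> /(rank_inj _ _ _ _ (trig _ _ _ a1) (trig _ _ _ a2)) e12.
  case: a2 => _; apply; rewrite -e12; apply: subset_trans (mono _ _ jk).
  by rewrite e1; exact: subsetUr.
have r_le j : i <= j -> r j <= rank s h.
  by move=> ij; have [s1 [h1 [[_ m1] _ ->]]] := rP j; exact/m1/act_j.
(* Pigeonhole: as long as the trigger stays active, the ranks applied are distinct and at most
   [rank s h], but there are [rank s h + 2] of them here. *)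
have uniq_r : uniq [seq r (i + j) | j <- iota 0 (rank s h).+2].
  rewrite map_inj_uniq ?iota_uniq // => j k E.
  by case: (ltngtP j k) => // jk; [case: (@r_neq (i + j) (i + k))|
    case: (@r_neq (i + k) (i + j))]; rewrite ?ltn_add2l.
have := uniq_leq_size (s2 := iota 0 (rank s h).+1) uniq_r.
rewrite size_map !size_iota ltnn => sub; suff: false by []; apply: sub.
by move=> _ /mapP[j _ ->]; rewrite mem_iota /= add0n ltnS r_le // leq_addr.
Qed.

(** A start instance with constants only keeps all chase terms within the encodable ones, so a
    derivation exists and the union in [chase_inst] is not empty. *)
Lemma chase_instE I : finite_set S -> (forall a, I a -> forall t, t \in a.2 ->
    exists c, t = Const c) ->
  chase_inst I S = least_chase I.
Proof.
move=> /finite_seqP[e Se] constI.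
have [J JI] : exists J, derivation_result I S J.
  (* The variable [0] is a dummy: the encoded null stands for the TGD with its frontier values,
     which determine the result of the trigger. *)
  pose rank s h := choice.pickle (encode_term e (Null s 0 [seq h y | y <- fr
    s])).
  apply: (@exists_derivation I rank) => s h s' h' [Ss hI] [Ss' hI'].
  have ok s1 h1 : S s1 -> hom (tgd_body s1) (least_chase I) h1 ->
      over_tgds e (Null s1 0 [seq h1 y | y <- fr s1]).
    move=> Ss1 hI1; have Se1 : forall s, S s -> s \in e by rewrite Se.
    rewrite /= Se1 //; apply/allP => _ /mapP[x + ->].
    rewrite mem_fr => /andP[/varsP[b bb xb] _].
    have /(chase_over_tgds Se1) okb := hI1 b bb.
    apply: (allP (okb _)); last exact: map_f.
    by move=> a Ia; apply/allP => t /(constI a Ia)[c ->].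
  move=> /(pcan_inj choice.pickleK)/encode_term_inj E.
  by have [<- /eq_result] := E (ok _ _ Ss hI) (ok _ _ Ss' hI').
apply/seteqP; split=> [a [J' /derivation_result_least ->] //|a].
by rewrite -(derivation_result_least JI); exists J.
Qed.
End Chase.

(** * Equality patterns of tuples *)

Section Patterns.
Variables (T : eqType).
Implicit Types (t : seq T) (c : T).

Lemma unique_tuple_rcons t c : unique_tuple (rcons t c) =
  if c \in t then unique_tuple t else rcons (unique_tuple t) c.
Proof. by rewrite /unique_tuple rev_rcons /= mem_rev; case: ifP;
  rewrite ?rev_cons. Qed.

Lemma mem_unique_tuple t : unique_tuple t =i t.
Proof. by move=> c; rewrite mem_rev mem_undup mem_rev. Qed.

Lemma unique_tuple_uniq t : uniq (unique_tuple t).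
Proof. by rewrite rev_uniq undup_uniq. Qed.

Lemma size_unique_tuple t : size (unique_tuple t) <= size t.
Proof. by rewrite size_rev -(size_rev t) size_undup. Qed.

Lemma idx_gt0 t c : 0 < idx t c. Proof. by []. Qed.

Lemma idx_le_unique t c : c \in t -> idx t c <= size (unique_tuple t).
Proof. by move=> ct; rewrite index_mem mem_unique_tuple. Qed.

Lemma idx_le t c : c \in t -> idx t c <= size t.
Proof. by move/idx_le_unique/leq_trans; apply; exact: size_unique_tuple. Qed.

Lemma onth_unique_tuple t c : c \in t -> onth (unique_tuple t) (idx t c).-1 =
  Some c.
Proof.
move=> ct; rewrite onthE (nth_map c) ?nth_index ?mem_unique_tuple //.
by rewrite index_mem mem_unique_tuple.
Qed.

Lemma onth_unique_idx t i c : onth (unique_tuple t) i = Some c -> i.+1 = idx t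
  c.
Proof.
move=> H; have lt_i : i < size (unique_tuple t) by rewrite -onthTE H.
by rewrite /idx -(onth_nth c c _ _ H) index_uniq ?unique_tuple_uniq.
Qed.

Lemma idx_inj t : {in t &, injective (idx t)}.
Proof.
move=> c c' ct c't [E]; rewrite -(nth_index c (s := unique_tuple t) (x := c)).
  by rewrite E nth_index // mem_unique_tuple.
by rewrite mem_unique_tuple.
Qed.

Lemma idx_rcons t c c' : c' \in t -> idx (rcons t c) c' = idx t c'.
Proof.
move=> c't; rewrite /idx unique_tuple_rcons; case: ifP => // _.
by rewrite -cats1 index_cat mem_unique_tuple c't.
Qed.

Lemma idx_rcons_new t c : c \notin t -> idx (rcons t c) c = (size (unique_tuple
  t)).+1.
Proof.
move=> /negbTE ct; rewrite /idx unique_tuple_rcons ct -cats1 index_cat.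
by rewrite mem_unique_tuple ct /= eqxx addn0.
Qed.

Lemma id_tuple_rcons t c :
  id_tuple (rcons t c) = rcons (id_tuple t) (idx (rcons t c) c).
Proof.
rewrite /id_tuple map_rcons; congr rcons; apply/eq_in_map => c'.
exact: idx_rcons.
Qed.

(** The left side is [spred_ar] of the simplified predicate, so the positions of that predicate
    correspond to the distinct terms of the atom. *)
Lemma max_id_tuple t : \max_(i <- id_tuple t) i = size (unique_tuple t).
Proof.
elim/last_ind: t => [|t c IH]; first by rewrite big_nil.
rewrite id_tuple_rcons -cats1 big_cat big_seq1 /= IH unique_tuple_rcons.
case: ifPn => ct; first by rewrite idx_rcons //; apply/maxn_idPl/idx_le_unique.
by rewrite idx_rcons_new // size_rcons; apply/maxn_idPr.
Qed.

Lemma max_ord_nth (u : seq nat) i : i <= size u ->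
  \max_(j < i) nth 0 u j = \max_(n <- take i u) n.
Proof.
move=> le_i; rewrite -(big_mkord xpredT (nth 0 u)) [in RHS](big_nth 0).
rewrite size_takel // big_nat [in RHS]big_nat.
by apply: eq_bigr => j /andP[_ ji]; rewrite nth_take.
Qed.

(** Restricted growth strings starting from 1: the condition on the guard of a Sigma-type, phrased
    with [take] to suit induction on the last entry. *)
Definition normal_tuple (u : seq nat) : Prop :=
  forall i, i < size u -> 1 <= nth 0 u i <= (\max_(n <- take i u) n).+1.

Lemma normal_rcons u (n : nat) : normal_tuple (rcons u n) <->
  normal_tuple u /\ 1 <= n <= (\max_(m <- u) m).+1.
Proof.
split=> [H|[H Hn] i].
  split; last first.
    have := H (size u); rewrite size_rcons ltnSn nth_rcons ltnn eqxx.
    by rewrite -cats1 take_size_cat // => /(_ isT).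
  move=> i iu; have := H i; rewrite size_rcons ltnS (ltnW iu) nth_rcons iu.
  by rewrite -cats1 takel_cat ?(ltnW iu) // => /(_ isT).
rewrite size_rcons ltnS leq_eqVlt nth_rcons => /predU1P[->|iu].
  by rewrite ltnn eqxx -cats1 take_size_cat.
by rewrite iu -cats1 takel_cat ?(ltnW iu) //; exact: H.
Qed.

Lemma normal_id_tuple t : normal_tuple (id_tuple t).
Proof.
elim/last_ind: t => [//|t c IH]; rewrite id_tuple_rcons; apply/normal_rcons.
split=> //; rewrite max_id_tuple idx_gt0 /=; case: (boolP (c \in t)) => ct.
  by rewrite idx_rcons //; apply/leqW/idx_le_unique.
by rewrite idx_rcons_new.
Qed.

End Patterns.

(** The values 1, 2, ... make their first appearances in increasing order, so each value is its own
    position among the distinct entries. *)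
Lemma id_normal_tuple (u : seq nat) : normal_tuple u -> id_tuple u = u.
Proof.
suff H : normal_tuple u -> unique_tuple u = iota 1 (\max_(n <- u) n).
  move=> nu; rewrite -[RHS]map_id; apply/eq_in_map => c cu; rewrite /idx H //.
  have : c \in iota 1 (\max_(n <- u) n) by rewrite -H // mem_unique_tuple.
  rewrite mem_iota add1n ltnS => /andP[c1 c2].
  have <- : nth 0 (iota 1 (\max_(n <- u) n)) c.-1 = c.
    by rewrite nth_iota ?prednK // add1n prednK.
  by rewrite index_uniq ?iota_uniq ?size_iota ?prednK // nth_iota ?prednK //
    add1n prednK.
elim/last_ind: u => [|u n IH]; first by rewrite big_nil.
move/normal_rcons => [/[dup] nu /IH E /andP[n1 n2]].
rewrite unique_tuple_rcons -mem_unique_tuple E mem_iota n1 add1n ltnS /=.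
rewrite -[rcons u n]cats1 big_cat big_seq1 /=; case: leqP => // nm.
have -> : n = (\max_(m <- u) m).+1 by apply/eqP; rewrite eqn_leq n2.
by rewrite -(addn1 (\max_(m <- u) m)) iotaD cats1 add1n addn1.
Qed.

(** Indices depend only on which variables are identified. This lets a specialization of variables
    be compared with the values of a trigger. *)
Lemma idx_map_eq (V T U : eqType) (f : V -> T) (g : V -> U) (vs : seq V) :
  {in vs &, forall x y, (f x == f y) = (g x == g y)} ->
  {in vs, forall x, idx (map f vs) (f x) = idx (map g vs) (g x)}.
Proof.
move=> fg; suff [] : size (unique_tuple (map f vs)) = size (unique_tuple (map g
  vs)) /\
    {in vs, forall x, idx (map f vs) (f x) = idx (map g vs) (g x)} by [].
elim/last_ind: vs fg => [//|vs v IH] fg; rewrite !map_rcons !unique_tuple_rcons.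
have [|sz E] := IH; first by move=> x y xv yv; apply: fg;
  rewrite mem_rcons in_cons (xv, yv) orbT.
have mem : (f v \in map f vs) = (g v \in map g vs).
  by apply/mapP/mapP => -[x xv /eqP e]; exists x => //; apply/eqP;
    [rewrite -fg|rewrite fg] => //; rewrite mem_rcons in_cons ?eqxx // xv orbT.
split; first by rewrite mem; case: ifP; rewrite ?size_rcons sz.
move=> x; rewrite mem_rcons in_cons => /orP[/eqP->|xv]; last first.
  by rewrite !idx_rcons ?map_f // E.
case: (boolP (f v \in map f vs)) => fv; last first.
  by rewrite !idx_rcons_new -?mem // sz.
rewrite !idx_rcons -?mem //; have /mapP[y yv e] := fv.
rewrite e E //; congr idx; apply/eqP;
  rewrite -fg ?e // mem_rcons in_cons ?eqxx //.
by rewrite yv orbT.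
Qed.

Lemma id_tuple_map_eq (V T U : eqType) (f : V -> T) (g : V -> U) (vs : seq V) :
  {in vs &, forall x y, (f x == f y) = (g x == g y)} ->
  id_tuple (map f vs) = id_tuple (map g vs).
Proof.
by move=> fg; rewrite /id_tuple -!map_comp; apply/eq_in_map; exact: idx_map_eq.
Qed.

Lemma idx_map_inj (T U : eqType) (f : T -> U) (t : seq T) (c : T) :
  {in t &, injective f} -> c \in t -> idx (map f t) (f c) = idx t c.
Proof.
move=> f_inj ct; rewrite -[in RHS](map_id t) (@idx_map_eq _ _ _ f id) // => x y
  xt yt.
by apply/eqP/eqP => [/f_inj|->] //; apply.
Qed.

Lemma id_tuple_map_inj (T U : eqType) (f : T -> U) (t : seq T) :
  {in t &, injective f} -> id_tuple (map f t) = id_tuple t.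
Proof.
by move=> f_inj; rewrite /id_tuple -map_comp; apply/eq_in_map => c;
  exact: idx_map_inj.
Qed.

Lemma id_tuple_pattern (V T U : eqType) (f : V -> T) (g : V -> U) (vs : seq V) :
  id_tuple (map f vs) = id_tuple (map g vs) ->
  {in vs &, forall x y, (f x == f y) = (g x == g y)}.
Proof.
rewrite /id_tuple -!map_comp => /eq_in_map E x y xv yv.
have Ex := E x xv; have Ey := E y yv; rewrite /= in Ex Ey.
apply/eqP/eqP => e.
  by apply: (@idx_inj _ (map g vs)); rewrite ?map_f // -Ex -Ey e.
by apply: (@idx_inj _ (map f vs)); rewrite ?map_f // Ex Ey e.
Qed.

Lemma same_pattern_id (T U : eqType) (t : seq T) (u : seq U) :
  same_pattern t u <-> id_tuple t = id_tuple u.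
Proof.
have nthE (V : eqType) (x : V) (v : seq V) i : i < size v -> onth v i = Some
  (nth x v i).
  by move=> iv; rewrite onthE (nth_map x).
case: t => [|x t]; case: u => [|y u]; try by split=> // -[].
set t' := x :: t; set u' := y :: u.
suff H : size t' = size u' ->
    (forall i j, i < size t' -> j < size t' -> (onth t' i = onth t' j <-> onth
      u' i = onth u' j))
    <-> id_tuple t' = id_tuple u'.
  split=> [[/H{}H /H]//|E]; have sz : size t' = size u'.
    by rewrite -(size_map (idx t')) -(size_map (idx u')) -/(id_tuple _) E.
  by split=> //; exact/H.
move=> sz; have tE : t' = map (nth x t') (iota 0 (size t')) by rewrite -/(mkseq
  _ _) mkseq_nth.
have uE : u' = map (nth y u') (iota 0 (size t')) by rewrite -/(mkseq _ _) sz
  mkseq_nth.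
split=> [H|E i j it jt]; last first.
  move: E; rewrite {1}tE {1}uE => /id_tuple_pattern/(_ i j).
  rewrite !mem_iota !add0n /= => /(_ it jt).
  rewrite !(nthE _ x t') // !(nthE _ y u') -?sz // => h.
  by split=> -[/eqP e]; congr Some; apply/eqP; [rewrite -h|rewrite h].
rewrite tE uE; apply: id_tuple_map_eq => i j.
rewrite !mem_iota !add0n /= => it jt; have := H i j it jt.
rewrite !(nthE _ x t') // !(nthE _ y u') -?sz //.
by move=> [h1 h2]; apply/eqP/eqP => e;
  [have [] := h1 (congr1 Some e)|have [] := h2 (congr1 Some e)].
Qed.

Lemma guardP (P : choiceType) (s : tgd P) (g : atom P var) : guard s = Some g ->
  g \in tgd_body s /\ {subset vars (tgd_body s) <= g.2}.
Proof.
rewrite /guard => E; have : g \in [seq a <- tgd_body s | guards s a].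
  by case: [seq _ <- _ | _] E => [|b bs] //= [<-]; exact: mem_head.
by rewrite mem_filter => /andP[/allP].
Qed.

Lemma guarded_guard (P : choiceType) (s : tgd P) :
  guarded s -> exists g, guard s = Some g.
Proof.
by rewrite /guarded /guard has_filter; case: [seq _ <- _ | _] => // g gs _;
  exists g.
Qed.

Lemma map_ground (P : Type) (T : Type) (f : term P -> T) (a : fact P) :
  map_atom f (ground a) = map_atom (f \o Const) a.
Proof. exact: map_atom_comp. Qed.

Lemma dom_map (P : Type) (T U : eqType) (f : T -> U) (a b : atom P T) :
  dom a `<=` dom b -> dom (map_atom f a) `<=` dom (map_atom f b).
Proof. by move=> ab _ /mapP[t ta ->]; apply/map_f/ab. Qed.

Lemma map_atom_id_in (P : Type) (T : eqType) (f : T -> T) (a : atom P T) :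
  {in a.2, forall t, f t = t} -> map_atom f a = a.
Proof. by case: a => p t fa; rewrite /map_atom /= map_id_in. Qed.

Lemma map_atom_inj_in (P : Type) (T U : eqType) (f : T -> U) (t : seq T)
    (a b : atom P T) :
  {in t &, injective f} -> map_atom f a = map_atom f b ->
  dom a `<=` [set` t] -> dom b `<=` [set` t] -> a = b.
Proof.
case: a b => p v [q w] f_inj [-> E] vt wt; congr pair.
elim: v w E vt wt => [|c v IH] [|d w] //= [cd E] vt wt; congr cons.
  by apply: f_inj cd; [apply: vt|apply: wt]; exact: mem_head.
by apply: IH => // x xv; [apply: vt|apply: wt];
  rewrite /= /dom /= in_cons xv orbT.
Qed.

Fixpoint subst_consts (P : Type) (f : const -> term P) (t : term P) : term P :=
  match t with
  | Const c => f c
  | Null s x us => Null s x (map (subst_consts f) us)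
  end.

Lemma trigger_subst_Null (P : choiceType) (s : tgd P) h x :
  x \notin fr s -> trigger_subst s h x = Null s x [seq h y | y <- fr s].
Proof. by rewrite /trigger_subst => /negbTE ->. Qed.

Lemma trigger_subst_fr (P : choiceType) (s : tgd P) h x :
  x \in fr s -> trigger_subst s h x = h x.
Proof. by rewrite /trigger_subst => ->. Qed.

(** TGDs are constant-free and a null is named by its frontier values, so replacing constants
    everywhere, also inside nulls, turns results of triggers into results of triggers. *)
Lemma least_chase_subst (P : choiceType) (S : set (tgd P)) (I J : instance P)
    (f : const -> term P) :
  (forall a, I a -> least_chase S J (map_atom (subst_consts f) a)) ->
  forall a, least_chase S I a -> least_chase S J (map_atom (subst_consts f) a).
Proof.
move=> IJ a; elim=> {a} [//|s h a Ss _ IH ah].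
have -> : map_atom (subst_consts f) (map_atom (trigger_subst s h) a) =
    map_atom (trigger_subst s (subst_consts f \o h)) a.
  rewrite map_atom_comp; apply: map_atom_eq => x _ /=.
  by rewrite /trigger_subst; case: ifP => //= _; rewrite -map_comp.
by apply: Chase_step => // b /IH; rewrite map_atom_comp.
Qed.

Lemma least_chase_sch (P : choiceType) (S : set (tgd P)) (I : instance P) a :
  least_chase S I a -> I a \/ sch S a.1.
Proof.
case=> {a} [a Ia|s h a Ss _ ah]; [by left|right; exists a => //].
by exists s => //=; rewrite mem_cat ah orbT.
Qed.

(** * Types of chase atoms *)

Section Types.
Variables (P : choiceType) (ar : P -> nat) (S : set (tgd P)) (C : instance P).

(** Facts of [D] may have predicates foreign to Sigma, atoms of a Sigma-type may not; hence the
    restriction to [sch S]. *)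
Definition type_set (a : atom P (term P)) : instance P :=
  [set b | [/\ C b, sch S b.1 & dom b `<=` dom a]].

Definition atom_type (a : atom P (term P)) : stype P :=
  (map_atom (idx a.2) a, map_atom (idx a.2) @` (type_set a `\ a)).

Lemma tatoms_atom_type a : C a -> sch S a.1 ->
  tatoms (atom_type a) = map_atom (idx a.2) @` type_set a.
Proof.
move=> Ca Sa; apply/seteqP; split=> [b [[c [cT _] <-]|->]|_ [c cT <-]].
- by exists c.
- by exists a => //; split.
- by case: (pselect (c = a)) => [->|ca]; [right|left; exists c].
Qed.

Lemma is_stype_atom_type a : (forall p, 0 < ar p) ->
  (forall b, C b -> wf_atom ar b) -> C a -> sch S a.1 ->
  is_stype ar S (atom_type a).
Proof.
move=> ar_gt0 wfC Ca Sa; have nrm := @normal_id_tuple _ a.2.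
have sz : size (id_tuple a.2) = ar a.1 by rewrite size_map; exact: wfC.
rewrite /is_stype /=; split.
- by split=> //; rewrite /wf_atom /= size_map; exact: wfC.
- have := nrm 0; rewrite sz ar_gt0 take0 big_nil => /(_ isT).
  by rewrite -eqn_leq => /eqP.
- by move=> i /andP[_ ia]; rewrite max_ord_nth ?(ltnW ia) //; exact: nrm.
- move=> _ [b [[Cb Sb ba] _] <-]; split=> //; last exact: dom_map.
  by rewrite /wf_atom /= size_map; exact: wfC.
- move=> [b [[_ _ ba] nb] /(map_atom_inj_in (@idx_inj _ a.2)) E].
  by apply: nb; apply: E.
Qed.
End Types.

Lemma finite_sch (P : choiceType) (S : set (tgd P)) :
  finite_set S -> finite_set (sch S).
Proof.
move=> fS; apply: finite_image; apply: bigcup_finite => // s _.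
exact: finite_seq.
Qed.

Lemma leq_max_ar (P : choiceType) (ar : P -> nat) (S : set (tgd P)) p :
  finite_set S -> sch S p -> ar p <= max_ar ar S.
Proof.
move=> fS Sp; rewrite /max_ar; apply: leq_bigmax_seq => //.
by rewrite in_fset_set ?inE //; exact: finite_sch.
Qed.

Lemma sch_body (P : choiceType) (S : set (tgd P)) s a :
  S s -> a \in tgd_body s -> sch S a.1.
Proof. by move=> Ss ab; exists a => //; exists s => //=;
  rewrite mem_cat ab. Qed.

Lemma sch_head (P : choiceType) (S : set (tgd P)) s a :
  S s -> a \in tgd_head s -> sch S a.1.
Proof. by move=> Ss ab; exists a => //; exists s => //=;
  rewrite mem_cat ab orbT. Qed.

Lemma least_chase_wf (P : choiceType) (ar : P -> nat) (S : set (tgd P)) I a :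
  (forall s, S s -> wf_tgd ar s) -> (forall b, I b -> wf_atom ar b) ->
  least_chase S I a -> wf_atom ar a.
Proof.
move=> wfS wfI; case=> {a} [//|s h a Ss _ ah].
have [_ _ /(_ a)] := wfS s Ss; rewrite /wf_atom /= size_map; apply.
by rewrite mem_cat ah orbT.
Qed.

(** * Head types are the types of the derived atoms *)

Section HeadType.
Variables (P : choiceType) (ar : P -> nat) (S : set (tgd P)) (I : instance P).
Hypotheses (finS : finite_set S) (wfS : forall s, S s -> wf_tgd ar s).
Hypothesis constI : forall a t, I a -> t \in a.2 -> exists c, t = Const c.
Hypothesis wfI : forall b, I b -> wf_atom ar b.
Hypothesis guardedS : forall s, S s -> guarded s.
Let C := least_chase S I.
Local Notation atype := (atom_type S C).

Variables (s : tgd P) (h : var -> term P) (g : atom P var) (hz : var -> const).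
Hypotheses (Ss : S s) (hC : hom (tgd_body s) C h) (gs : guard s = Some g).
Let al := map_atom h g.
Hypothesis hzE : {in fr s, forall x, hz x = idx al.2 (h x)}.
Let us := [seq h y | y <- fr s].
Let f := lin_map ar S s hz.
Let th := trigger_subst s h.
Let J := inst_of (lin_inst ar S s (atype al) hz).

Let Cal : C al. Proof. by apply: hC; have [] := guardP gs. Qed.
Let Sal : sch S al.1. Proof. by apply: sch_body Ss _; have [] := guardP gs. Qed.

Let h_al x : x \in vars (tgd_body s) -> h x \in al.2.
Proof. by have [_ sub] := guardP gs; move/sub; exact: map_f. Qed.

Let us_al : {subset us <= al.2}.
Proof. by move=> _ /mapP[x + ->]; rewrite mem_fr => /andP[/h_al]. Qed.

Let idx_al t : t \in al.2 -> idx al.2 t <= max_ar ar S.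
Proof.
move=> tal; apply: leq_trans (@leq_max_ar _ ar _ _ finS Sal).
by have <- : size al.2 = ar al.1 by [apply: least_chase_wf Cal]; exact: idx_le.
Qed.

(* [label] takes the frontier values and the new nulls to the integers that
   represent them in [head_type], and [unlabel] is its inverse. *)
Let unlabel (c : const) : term P :=
  if c <= max_ar ar S then nth (Const 0) (unique_tuple al.2) c.-1
  else Null s (nth 0 (exvars s) (c - max_ar ar S).-1) us.

Let unlabel_idx t : t \in al.2 -> unlabel (idx al.2 t) = t.
Proof.
by move=> tal; rewrite /unlabel idx_al //= nth_index // mem_unique_tuple.
Qed.

Let unlabel_f x : x \in vars (tgd_head s) -> unlabel (f x) = th x.
Proof.
move=> xh; rewrite /f /lin_map /th /trigger_subst; case: ifPn => xfr.
  rewrite hzE // unlabel_idx // h_al //; by move: xfr;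
    rewrite mem_fr => /andP[].
have xex : x \in exvars s.
  by move: xfr; rewrite mem_fr mem_exvars xh andbT => ->.
rewrite /unlabel -[X in _ <= X]addn0 leq_add2l /= addKn /= nth_index //.
Qed.

(** The integers of the small instance stand for chase terms; substituting these terms sends its
    atoms into the chase, hence also everything derived from them. *)
Let sound b : least_chase S J (ground b) -> C (map_atom unlabel b).
Proof.
suff JC a : J a -> C (map_atom (subst_consts unlabel) a).
  by move=> /(least_chase_subst JC); rewrite map_ground.
move=> [b' [[c /= ch <-]|tb] <-]; rewrite map_ground.
  rewrite map_atom_comp (@map_atom_eq _ _ _ _ th) => [|x xc]; last first.
    by rewrite /= unlabel_f //; exact: mem_vars ch xc.
  by apply: Chase_step.
move: tb; rewrite tatoms_atom_type // => -[c [Cc _ cal] <-].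
rewrite map_atom_comp map_atom_id_in // => t tc; rewrite /= unlabel_idx //;
  exact: cal.
Qed.

(** Any variable name is accepted: what identifies a null of the trigger is the TGD with its
    frontier values. *)
Let new (t : term P) : bool :=
  if t is Null s0 _ us0 then (s0 == s) && (us0 == us) else false.

Fixpoint rooted (t : term P) : bool :=
  new t || (if t is Null _ _ us0 then has rooted us0 else false).

Let w (t : term P) : const :=
  if t \in us then idx al.2 t
  else if t is Null _ z _ then max_ar ar S + (index z (exvars s)).+1 else 0.

Fixpoint label (t : term P) : term P :=
  if (t \in us) || new t then Const (w t)
  else if t is Null s0 z us0 then Null s0 z (map label us0) else t.

(** A term built from a new null is deeper than every frontier value. Hence no frontier value is
    rooted, and the two cases of [label] exclude each other. *)
Let rooted_depth t : rooted t -> (\max_(n <- map (@depth P) us) n).+1 <= depth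
  t.
Proof.
elim/term_ind_in: t => [//|s0 z us0 IH] /= /orP[/andP[_ /eqP->] //|/hasP[u uus
  ru]].
rewrite ltnS; apply: leq_trans (leq_depth_args uus).
exact: leq_trans (leqnSn _) (IH u uus ru).
Qed.

Let us_not_rooted t : t \in us -> ~~ rooted t.
Proof.
by move=> tus; apply/negP => /rooted_depth; rewrite ltnNge leq_depth_args.
Qed.

Let new_rooted t : new t -> rooted t.
Proof. by case: t => //= s0 z us0 ->. Qed.

Let w_th x : x \in vars (tgd_head s) -> w (th x) = f x.
Proof.
move=> xh; rewrite /f /lin_map /w /th /trigger_subst;
  case: (boolP (x \in fr s)) => xfr.
  by rewrite map_f // hzE.
by case: ifP => // /us_not_rooted; rewrite /= !eqxx.
Qed.

Let th_label x : (th x \in us) || new (th x).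
Proof.
rewrite /th /trigger_subst; case: ifPn => xfr; first by rewrite map_f.
by rewrite /= !eqxx orbT.
Qed.

Let label_th x : x \in vars (tgd_head s) -> label (th x) = Const (f x).
Proof.
by move=> xh; rewrite -w_th //; have := th_label x;
  case: (th x) => [c|s0 z us0] /= ->.
Qed.

Let label_us t : t \in us -> label t = Const (idx al.2 t).
Proof. by rewrite /w; case: t => [c|s0 z us0] /= tus; rewrite /w tus. Qed.

(** Frontier values occur in the guard atom, so such an atom belongs to the type of the guard, which
    is part of the small instance. *)
Let label_old b : C b -> sch S b.1 -> dom b `<=` [set` us] ->
  least_chase S J (map_atom label b).
Proof.
move=> Cb Sb bus; apply: Chase_base; exists (map_atom (idx al.2) b).
  right; rewrite tatoms_atom_type //; exists b => //; split=> // t /bus.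
  exact: us_al.
by rewrite /ground map_atom_comp; apply: map_atom_eq => t /bus /label_us ->.
Qed.

(* The chase atoms with a descendant of the new nulls are derived from [J]
   alone: a guard containing such a descendant has no other terms than values of
   the frontier and descendants. *)
Let label_rooted b : C b -> has rooted b.2 ->
  {in b.2, forall t, ~~ rooted t -> t \in us} /\ least_chase S J (map_atom
    label b).
Proof.
elim=> {b} [b Ib /hasP[t /(constI Ib)[c ->]] //|s1 h1 b Ss1 hC1 IH bh rb].
(* If a frontier value is rooted, so is a term of the guard; by induction all other values of body
   variables are then in [us], since the guard contains every body variable. *)
case: (boolP (has (rooted \o h1) (fr s1))) => [/hasP[y yfr /= ry]|nr].
  have [g1 gs1] := guarded_guard (guardedS Ss1).
  have [g1b g1v] := guardP gs1.
  have old x : x \in vars (tgd_body s1) -> ~~ rooted (h1 x) -> h1 x \in us.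
    move=> xb; have [|+ _] := IH g1 g1b.
      by apply/hasP; exists (h1 y) => //; apply/map_f/g1v; move: yfr;
        rewrite mem_fr => /andP[].
    by apply; apply/map_f/g1v.
  have nullP z : let t := Null s1 z [seq h1 y | y <- fr s1] in rooted t /\
      label t = Null s1 z [seq label (h1 y) | y <- fr s1].
    have r : has rooted [seq h1 y | y <- fr s1] by rewrite has_map;
      apply/hasP; exists y.
    have rt : rooted (Null s1 z [seq h1 y | y <- fr s1]) by rewrite /= r orbT.
    split=> //; rewrite /= (negbTE (contraL (@us_not_rooted _) rt)) /=.
    case: ifP => [/andP[_ /eqP e]|_]; last by rewrite -map_comp.
    by move: r; rewrite e => /hasP[u /us_not_rooted/negbTE->].
  split=> [_ /mapP[x xb ->]|].
    rewrite /trigger_subst; case: ifP => [|_]; last by rewrite (nullP x).1.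
    by rewrite mem_fr => /andP[/old].
  have -> : map_atom label (map_atom (trigger_subst s1 h1) b) =
      map_atom (trigger_subst s1 (label \o h1)) b.
    rewrite map_atom_comp; apply: map_atom_eq => x _ /=; rewrite /trigger_subst.
    by case: ifP => // _; rewrite (nullP x).2.
  apply: Chase_step => // a ab; rewrite -map_atom_comp.
  (* A body atom with a rooted term is covered by induction; one without has only frontier values of
     [s] as terms. *)
  case: (boolP (has rooted (map_atom h1 a).2)) => [/(IH a ab)[]//|/hasPn na].
  apply: label_old; [exact: hC1|exact: sch_body ab|].
  by move=> _ /mapP[x xa ->]; apply: old;
    [exact: mem_vars ab xa|apply/na/map_f].
have fr_old x : x \in fr s1 -> ~~ rooted (h1 x) by move=> xfr;
  have /hasPn := nr; apply.
have [x xb rx] : exists2 x, x \in b.2 & rooted (trigger_subst s1 h1 x).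
  by have /hasP[_ /mapP[x xb ->] rx] := rb; exists x.
(* No frontier value is rooted, so the rooted term is a null created here that is itself new: the
   trigger is [s] with the frontier values of [h]. *)
have [es eus] : s1 = s /\ [seq h1 y | y <- fr s1] = us.
  move: rx; rewrite /trigger_subst; case: ifPn => [/fr_old/negbTE-> //|_] /=.
  case/orP=> [/andP[/eqP-> /eqP->] //|]; rewrite has_map.
  by move/(elimN idP): nr.
subst s1; have h1E : {in fr s, h1 =1 h} by apply/eq_in_map.
have thE y : trigger_subst s h1 y = th y.
  by rewrite /th /trigger_subst eus; case: ifP => // /h1E.
split=> [_ /mapP[y yb ->]|].
  rewrite thE; have /orP[//|/new_rooted ->//] := th_label y.
apply: Chase_base; exists (map_atom f b); first by left; exists b.
rewrite /ground !map_atom_comp; apply: map_atom_eq => y yb /=.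
by rewrite thE label_th //; exact: mem_vars bh yb.
Qed.

(** The small chase is sound for the full one by [unlabel] and complete over the terms of the head
    atom by [label]; both are injective there, so renaming by first occurrence gives the same
    type. *)
Lemma head_type_atom_type a : a \in tgd_head s ->
  head_type ar S s (atype al) hz a = atype (map_atom th a).
Proof.
move=> ah; have ahv x : x \in a.2 -> x \in vars (tgd_head s) by exact: mem_vars.
set be := map_atom th a; set aa := map_atom f a.
have unl_aa : map_atom unlabel aa = be.
  by rewrite map_atom_comp; apply: map_atom_eq => x /ahv /unlabel_f.
have unl_inj : {in aa.2 &, injective unlabel}.
  move=> _ _ /mapP[x /ahv xh ->] /mapP[y /ahv yh ->].
  by rewrite !unlabel_f // => E; rewrite -!w_th // E.
have idxE c : c \in aa.2 -> idx be.2 (unlabel c) = idx aa.2 c.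
  by move=> caa; rewrite -unl_aa; exact: idx_map_inj.
rewrite /head_type -/f -/aa /atom_type -/be; congr pair.
  transitivity (map_atom (idx be.2) (map_atom unlabel aa));
    last by rewrite unl_aa.
  by rewrite [RHS]map_atom_comp; apply: map_atom_eq => c /idxE.
have JE : chase (lin_inst ar S s (atype al) hz) S = least_chase S J.
  rewrite /chase chase_instE // => c [d _ <-] t /mapP[e _ ->].
  by exists e.
apply/seteqP; split=> [_ [b [[[+ _] ba] nb] <-]|_ [b [[Cb Sb bb] nb] <-]].
  rewrite JE => Jb.
  exists (map_atom unlabel b); last first.
    by rewrite map_atom_comp; apply: map_atom_eq => c /ba /idxE.
  split; last first.
    move=> E; apply: nb; apply: (map_atom_inj_in unl_inj) => //.
    by rewrite unl_aa.
  split; [exact: sound| |by rewrite -unl_aa; exact: dom_map].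
  have [[b' [[c ch <-]|]]|//] := least_chase_sch Jb.
    by move=> /(congr1 fst) /= <-; exact: sch_head ch.
  by rewrite tatoms_atom_type // => -[c [_ ? _] <-] /(congr1 fst) /= <-.
have bth t : t \in b.2 -> exists2 x, x \in a.2 & t = th x by move/bb/mapP.
have unl_w t : t \in b.2 -> unlabel (w t) = t.
  by move/bth => [x /ahv xh ->]; rewrite w_th // unlabel_f.
have wb_aa : dom (map_atom w b) `<=` dom aa.
  move=> _ /mapP[t /bth[x xa ->] ->]; rewrite w_th ?ahv //; exact: map_f.
exists (map_atom w b); last first.
  rewrite map_atom_comp; apply: map_atom_eq => t tb /=.
  by rewrite -idxE ?unl_w //; apply: wb_aa; exact: map_f.
split; last first.
  move=> E; apply: nb; rewrite /= -unl_aa -/aa -E map_atom_comp map_atom_id_in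
    //.
split=> //; have gE : ground (map_atom w b) = map_atom label b.
  rewrite /ground map_atom_comp; apply: map_atom_eq => t /bth[x /ahv xh ->] /=.
  by rewrite w_th // label_th.
have Jaa : lin_inst ar S s (atype al) hz aa by left; exists a.
rewrite /complete /= JE; split; last first.
  by move=> _ /mapP[c /wb_aa caa ->]; exists (ground aa);
    [exists aa|exact: map_f].
(* Terms of a head atom are frontier values or new nulls, so an atom over them without a rooted term
   has frontier values only. *)
rewrite gE; case: (boolP (has rooted b.2)) => [/(label_rooted Cb)[]//|/hasPn
  nr].
apply: label_old => // t tb; have [x xa tE] := bth t tb.
by have := th_label x; rewrite -tE => /orP[//|/new_rooted];
  rewrite (negbTE (nr t tb)).
Qed.
End HeadType.

Lemma replace_idx (t : seq const) c : c \in t -> replace (id_tuple t) t (idx t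
  c) = c.
Proof.
move=> ct; rewrite /replace; have : idx t c \in id_tuple t by exact: map_f.
set i := index _ _; rewrite -index_mem -/i size_map => it.
have := @idx_inj _ t _ c (mem_nth (idx t c) it) ct; apply.
by rewrite -(nth_map _ 0) // nth_index // map_f.
Qed.

Lemma idx_Const (P : Type) (t : seq const) c : c \in t ->
  idx (map (@Const P) t) (Const c) = idx t c.
Proof. by apply: idx_map_inj => x y _ _ []. Qed.

Lemma id_tuple_Const (P : Type) (t : seq const) :
  id_tuple (map (@Const P) t) = id_tuple t.
Proof. by apply: id_tuple_map_inj => x y _ _ []. Qed.

Lemma stype_guard_normal (P : choiceType) (ar : P -> nat) S (tau : stype P) :
  is_stype ar S tau -> normal_tuple (tguard tau).2.
Proof.
case: tau => -[p t] T [/= _ t0 H _ _] i it; rewrite -max_ord_nth;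
  last exact: ltnW.
by case: i it => [|i] it; [rewrite /= t0|exact: H].
Qed.

(** * Linearization and simplification *)

Section LinDb.
Variables (P : choiceType) (ar : P -> nat) (D : set (fact P)) (S : set (tgd P)).
Hypothesis ar_gt0 : forall p, 0 < ar p.
Hypotheses (finS : finite_set S) (wfS : forall s, S s -> wf_tgd ar s).
Hypothesis wfD : forall a, D a -> wf_atom ar a.
Let C := least_chase S (inst_of D).
Local Notation atype := (atom_type S C).

Lemma inst_of_const a t : inst_of D a -> t \in a.2 -> exists c, t = Const c.
Proof. by move=> [b _ <-] /mapP[c _ ->]; exists c. Qed.

Lemma chaseE : chase D S = C.
Proof. by apply: chase_instE => // a Da t; exact: inst_of_const. Qed.

Lemma inst_of_wf a : inst_of D a -> wf_atom ar a.
Proof. by move=> [b /wfD + <-]; rewrite /wf_atom /= size_map. Qed.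

Lemma chase_wf a : C a -> wf_atom ar a.
Proof. exact: least_chase_wf inst_of_wf. Qed.

(** A fact [(tau, t)] records [R] only through the guard of [tau], hence the extra equation. The
    guard must be [id_tuple t], being a normal tuple with the pattern of [t], and instantiating by
    [t] inverts the renaming, so the remaining atoms are determined too. *)
Lemma lin_db_typeP R t (tau : stype P) : D (R, t) ->
  lin_db ar D S (tau, t) /\ (tguard tau).1 = R <->
  sch S R /\ tau = atype (ground (R, t)).
Proof.
move=> DRt; set a := ground (R, t).
have Ca : C a by apply: Chase_base; exists (R, t).
have type_ofE : type_of D S a `&` [set c | sch S c.1] = type_set S C a.
  rewrite /type_of chaseE; apply/seteqP.
  by split=> b [] // [? ?] ?; split.
have replK b : dom b `<=` dom a ->
    ground (map_atom (replace (id_tuple t) t) (map_atom (idx a.2) b)) = b.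
  move=> ba; rewrite /ground !map_atom_comp map_atom_id_in // => c /ba /mapP[d
    dt ->] /=.
  by rewrite idx_Const // replace_idx.
have idxK b : dom b `<=` [set` id_tuple t] ->
    map_atom (idx a.2) (ground (map_atom (replace (id_tuple t) t) b)) = b.
  move=> bt; rewrite /ground !map_atom_comp map_atom_id_in // => c /bt /mapP[d
    dt ->] /=.
  by rewrite replace_idx // idx_Const.
have guardE : map_atom (idx a.2) a = (R, id_tuple t).
  by rewrite -(id_tuple_Const P).
split=> [[[R0 [_ [_ [[<- <-] _ st [<- pat] E]]]] gR]|[SR ->]].
  have nrm := stype_guard_normal st; have idE := id_normal_tuple nrm.
  have gt : (tguard tau).2 = id_tuple t by rewrite -idE; apply/same_pattern_id.
  have gE : tau.1 = (R, id_tuple t) by rewrite -gR -gt -surjective_pairing.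
  move: E; rewrite /= -/(tguard tau) gR -/a type_ofE => E.
  case: tau st gR pat nrm idE gt gE E => al T [/= [Sal _] _ _ TT nT] gR _ _ _
    gt gE E.
  split; first by rewrite -gR.
  rewrite /atom_type -/a guardE -gE; congr pair.
  have domT b : T b -> dom b `<=` [set` id_tuple t].
    by move=> /TT[_ _]; rewrite /dom gt.
  have tinstP b : inst_of (tinst (al, T) t) b <->
      exists2 c, T c \/ c = al & b = ground (map_atom (replace (id_tuple t) t)
        c).
    split=> [[_ [c cT <-] <-]|[c cT ->]]; first by exists c; rewrite //= -gt.
    by exists (map_atom (replace (id_tuple t) t) c) => //; exists c => //;
      rewrite -gt.
  apply/seteqP; split=> [b Tb|_ [b [+ nb] <-]].
    exists (ground (map_atom (replace (id_tuple t) t) b));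
      last by apply/idxK/domT.
    split; first by rewrite -E; apply/tinstP; exists b => //; left.
    move=> /(congr1 (map_atom (idx a.2))); rewrite idxK; last exact: domT.
    by rewrite guardE -gE => eb; apply: nT; rewrite -eb.
  rewrite -E => /tinstP[c [Tc|ec] eb].
    by rewrite eb idxK //; exact: domT.
  by case: nb; rewrite eb ec gE -guardE replK.
split=> //; exists R, t, (atype a); split=> //.
- by apply: is_stype_atom_type => //; exact: chase_wf.
- split=> //; rewrite /tguard [(atype a).1]guardE /=; apply/same_pattern_id.
  by rewrite id_normal_tuple //; exact: normal_id_tuple.
rewrite -/a type_ofE /tinst tatoms_atom_type //.
rewrite /tguard [(atype a).1]guardE /=; apply/seteqP; split=> [b|b bT].
  by move=> [_ [_ [c cT <-] <-] <-]; rewrite replK //; case: cT.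
exists (map_atom (replace (id_tuple t) t) (map_atom (idx a.2) b)); last first.
  by rewrite replK //; case: bT.
by exists (map_atom (idx a.2) b) => //; exists b.
Qed.
End LinDb.

(** * Triggers of the chase as simplified linear TGDs *)

Section Simulation.
Variables (P : choiceType) (ar : P -> nat) (D : set (fact P)) (S : set (tgd P)).
Hypothesis ar_gt0 : forall p, 0 < ar p.
Hypotheses (finS : finite_set S) (wfS : forall s, S s -> wf_tgd ar s).
Hypotheses (wfD : forall a, D a -> wf_atom ar a).
Hypothesis guardedS : forall s, S s -> guarded s.
Let C := least_chase S (inst_of D).
Local Notation atype := (atom_type S C).
Let S' := simple (lin ar S).

Definition atom_pred (a : atom P (term P)) : spred (stype P) :=
  (atype a, id_tuple a.2).

Definition spec_subst (g : atom P var) (f : var -> var) (x : var) : var :=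
  if x \in g.2 then f x else x.

Definition spec_like (g : atom P var) (h : var -> term P) (f : var -> var) :=
  {in g.2 &, forall x y, (f x == f y) = (h x == h y)} /\
  {in g.2, forall x, f x \in g.2}.

(* The simplified linear TGD that simulates the trigger [(s, h)] when the
   specialization [f] identifies the same variables as [h]. *)
Definition simulating_tgd (s : tgd P) (g : atom P var) (h : var -> term P)
    (f : var -> var) : tgd (spred (stype P)) :=
  ([:: (atom_pred (map_atom h g), unique_tuple (map f g.2))],
   [seq (atom_pred (map_atom (trigger_subst s h) a),
         unique_tuple (map (spec_subst g f) a.2)) | a <- tgd_head s]).

(** A null has the frontier values among its arguments and is deeper than each of them, so it equals
    none. *)
Lemma trigger_subst_eq (s : tgd P) (h : var -> term P) x y : x \notin fr s ->
  (trigger_subst s h x == trigger_subst s h y) = (x == y).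
Proof.
move=> xfr; rewrite /trigger_subst (negbTE xfr); case: ifPn => yfr.
  rewrite [RHS](_ : _ = false); last by apply: contraNF xfr => /eqP->.
  apply/eqP => E; have := depth_Null_gt s x (map_f h yfr).
  by rewrite E ltnn.
by apply/eqP/eqP => [[]|->].
Qed.

(** On frontier variables [f] and [h] identify alike. An existential variable collides with nothing
    on either side: [f] takes guard variables to guard variables, and a null is no frontier
    value. *)
Lemma spec_subst_eq s g h f : guard s = Some g -> spec_like g h f ->
  {in vars (tgd_head s) &, forall x y,
    (spec_subst g f x == spec_subst g f y) =
    (trigger_subst s h x == trigger_subst s h y)}.
Proof.
move=> /guardP[gb gv] [fh fg] x y xh yh.
have frE z : z \in vars (tgd_head s) -> (z \in fr s) = (z \in g.2).
  by move=> zh; rewrite mem_fr zh andbT; apply/idP/idP => [/gv//|];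
    exact: mem_vars.
rewrite /spec_subst -!frE //; case: (boolP (x \in fr s)) => xfr; last first.
  rewrite trigger_subst_eq //; case: ifPn => // yfr.
  have ne u : u \in g.2 -> x != u.
    by move=> ug; apply: contraNneq xfr => xu; rewrite frE // xu.
  have yg : y \in g.2 by rewrite -frE.
  by rewrite (negbTE (ne _ yg)) (negbTE (ne _ (fg _ yg))).
case: (boolP (y \in fr s)) => yfr; last first.
  rewrite [RHS]eq_sym trigger_subst_eq // eq_sym.
  have ne u : u \in g.2 -> y != u.
    by move=> ug; apply: contraNneq yfr => yu; rewrite frE // yu.
  have xg : x \in g.2 by rewrite -frE.
  by rewrite (negbTE (ne _ xg)) (negbTE (ne _ (fg _ xg))).
by rewrite !trigger_subst_fr // fh // -frE.
Qed.

Lemma simple_lin_tgd s g h hz f : S s -> hom (tgd_body s) C h ->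
  guard s = Some g -> spec_like g h f ->
  {in fr s, forall x, hz x = idx (map_atom h g).2 (h x)} ->
  ([:: simple_atom (map_atom f (atype (map_atom h g), g.2))],
   [seq simple_atom (map_atom (fun x => if x \in g.2 then f x else x)
      (head_type ar S s (atype (map_atom h g)) hz a, a.2)) | a <- tgd_head s])
  = simulating_tgd s g h f.
Proof.
move=> Ss hC gs fh hzE; congr pair.
  rewrite /simple_atom /atom_pred /=; congr [:: ((_, _), _)].
  by apply: id_tuple_map_eq; case: fh.
apply/eq_in_map => a ah; rewrite /simple_atom /atom_pred /=; congr ((_, _), _).
  rewrite (head_type_atom_type finS wfS _ _ guardedS Ss hC gs) //.
  - by move=> b t; exact: inst_of_const.
  - exact: inst_of_wf.
apply: id_tuple_map_eq => x y xa ya.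
by apply: (spec_subst_eq gs fh); exact: mem_vars ah _.
Qed.

Lemma simulating_tgd_exists s g h : S s -> hom (tgd_body s) C h ->
  guard s = Some g -> exists f, spec_like g h f /\ S' (simulating_tgd s g h f).
Proof.
move=> Ss hC gs; have [gb gv] := guardP gs.
(* Each guard variable goes to the first guard variable with the same value; this choice meets the
   order condition of a specialization. *)
pose f x := nth 0 g.2 (index (h x) (map h g.2)).
have idx_lt x : x \in g.2 -> index (h x) (map h g.2) < size g.2.
  by move=> xg; rewrite -(size_map h) index_mem map_f.
have hf x : x \in g.2 -> h (f x) = h x.
  move=> xg; rewrite /f -(nth_map _ (h 0)) ?nth_index ?map_f //.
  exact: idx_lt.
have fh : spec_like g h f.
  split=> [x y xg yg|x /idx_lt]; last exact: mem_nth.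
  apply/eqP/eqP => [E|E]; first by rewrite -hf // E hf.
  by rewrite /f E.
exists f; split=> //.
pose hz x := idx (map_atom h g).2 (h x).
rewrite -(@simple_lin_tgd s g h hz f) //.
have Cal : C (map_atom h g) by exact: hC.
have Sal : sch S (map_atom h g).1 by exact: sch_body Ss gb.
exists ([:: (atype (map_atom h g), g.2)],
  [seq (head_type ar S s (atype (map_atom h g)) hz a, a.2) | a <- tgd_head s]).
  exists s => //; exists g, (atype (map_atom h g)), hz; split=> //.
  - by apply: is_stype_atom_type => //; exact: chase_wf.
  - move=> b bb; rewrite tatoms_atom_type //; exists (map_atom h b).
      split; [exact: hC|exact: sch_body bb|].
      by move=> _ /mapP[x xb ->]; apply/map_f/gv/(mem_vars bb).
    by rewrite map_atom_comp.
  - by rewrite /= map_atom_comp.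
exists (atype (map_atom h g), g.2), f; split=> //.
  move=> i ig /=; set x := nth 0 g.2 i.
  have xg : x \in g.2 by exact: mem_nth.
  have le_i : index (h x) (map h g.2) <= i.
    by rewrite -[h x](nth_map _ (h 0)) // index_nth ?size_map.
  (* Either [x] is itself the first variable with its value and is kept, or an earlier variable has
     the same value and hence the same image. *)
  rewrite mem_rcons in_cons /f; move: le_i;
    rewrite leq_eqVlt => /predU1P[->|lt_i].
    by rewrite eqxx.
  have [lt_ih ig'] := (leq_ltn_trans (ltnW lt_i) ig, leq_trans lt_i (ltnW ig)).
  set j := index _ _ in lt_i lt_ih *; set y := nth 0 g.2 j.
  apply/orP; right; apply/mapP; exists y.
    by rewrite /y -(nth_take 0 lt_i) mem_nth // size_take ig.
  rewrite /f.
  suff -> : h y = h x by [].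
  by rewrite /y -(nth_map _ (h 0)) // nth_index // map_f.
by congr pair; rewrite -map_comp.
Qed.

Lemma specialization_mem (xs : seq var) f : specialization xs f ->
  {in xs, forall x, f x \in xs}.
Proof.
move=> sp x xxs; rewrite -(nth_index 0 xxs).
have := xxs; rewrite -index_mem; move: (index x xs) => i.
elim/ltn_ind: i => i IH ixs; have := sp i ixs; rewrite /=.
rewrite mem_rcons in_cons => /predU1P[->|]; first exact: mem_nth.
move=> /mapP[y + ->]; move=> /(nthP 0)[j]; rewrite size_take ixs => ji <-.
by rewrite nth_take //; apply: IH => //; exact: ltn_trans ixs.
Qed.

(** The converse of [simulating_tgd_exists]. Reading the integers of the type as the terms of [al]
    turns the homomorphism into the type into a trigger with guard [al], because the atoms of the
    type are renamed chase atoms. *)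
Lemma simple_lin_simulating s' al : S' s' -> C al -> sch S al.1 ->
  atom_pred al \in [seq a.1 | a <- tgd_body s'] ->
  exists s g h f, [/\ S s, hom (tgd_body s) C h, guard s = Some g,
    spec_like g h f & al = map_atom h g /\ s' = simulating_tgd s g h f].
Proof.
move=> [_ [s Ss [g [tau [hz [gs _ hom_hz gtau ->]]]]]] [_ [f [[<-] sp ->]]] Cal
  Sal.
rewrite /= inE => /eqP[etau eid]; rewrite -etau in hom_hz gtau *.
have [gb gv] := guardP gs.
pose h x : term P := nth (Const 0) (unique_tuple al.2) (hz x).-1.
have [g1 g2] : al.1 = g.1 /\ id_tuple al.2 = map hz g.2 by case: gtau.
have nthK t : t \in al.2 -> nth (Const 0) (unique_tuple al.2) (idx al.2 t).-1 =
  t.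
  by move=> tal; rewrite /= nth_index // mem_unique_tuple.
have alE : al = map_atom h g.
  rewrite [LHS]surjective_pairing g1; congr pair.
  rewrite /h (map_comp (fun n => nth _ _ n.-1)) -g2 -map_comp /=.
  by rewrite map_id_in // => t /nthK.
have hzE x : x \in g.2 -> hz x = idx al.2 (h x).
  move=> xg; have : hz x \in id_tuple al.2 by rewrite g2 map_f.
  by move=> /mapP[t tal e]; rewrite /h e nthK.
have hC : hom (tgd_body s) C h.
  move=> a ab; have := hom_hz a ab; rewrite tatoms_atom_type //.
  move=> [c [Cc _ cal] e]; suff -> : map_atom h a = c by [].
  have -> : map_atom h a = map_atom (fun n => nth (Const 0) (unique_tuple al.2)
    n.-1) (map_atom hz a).
    by rewrite map_atom_comp.
  by rewrite -e map_atom_comp map_atom_id_in // => t /cal /nthK.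
have fh : spec_like g h f.
  split; last exact: specialization_mem.
  by apply: id_tuple_pattern;
    rewrite -[RHS](congr1 (fun a => id_tuple a.2) alE).
exists s, g, h, f; split=> //; split=> //;
  rewrite -(@simple_lin_tgd s g h hz f) // -?alE.
- by rewrite -map_comp.
- by move=> x; rewrite mem_fr => /andP[/gv/hzE].
Qed.

(** After simplification every term occurs once in its atom, so the atom and the term determine a
    single position. *)
Definition atom_pos (a : atom P (term P)) (t : term P) :
    position (spred (stype P)) := (atom_pred a, idx a.2 t).

Section OneTrigger.
Variables (s : tgd P) (g : atom P var) (h : var -> term P) (f : var -> var).
Hypotheses (gs : guard s = Some g) (fh : spec_like g h f).
Let al := map_atom h g.
Let th := trigger_subst s h.
Let sim := simulating_tgd s g h f.

Lemma head_var_fr x : x \in vars (tgd_head s) -> (x \in fr s) = (x \in g.2).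
Proof.
have [gb gv] := guardP gs => xh; rewrite mem_fr xh andbT.
by apply/idP/idP => [/gv//|]; exact: mem_vars.
Qed.

Lemma simulating_body_at y : y \in g.2 ->
  occurs_at (f y) (tgd_body sim) (atom_pos al (h y)).
Proof.
move=> yg; exists (atom_pred al, unique_tuple (map f g.2)); split=> //.
  exact: mem_head.
rewrite /atom_pos [_.2]/= -(idx_map_eq (proj1 fh)) //.
exact/onth_unique_tuple/map_f.
Qed.

Lemma simulating_body_atP x p : occurs_at x (tgd_body sim) p ->
  exists y, [/\ y \in g.2, x = f y & p = atom_pos al (h y)].
Proof.
case: p => R [|i] [a []]; rewrite //= inE => /eqP-> /= <- _ E.
have : x \in map f g.2 by rewrite -mem_unique_tuple; apply/onthP; exists i.
move=> /mapP[y yg xy]; exists y; split=> //; congr pair.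
by rewrite -(idx_map_eq (proj1 fh)) // -xy; exact: onth_unique_idx.
Qed.

Lemma simulating_head_at a x : a \in tgd_head s -> x \in a.2 ->
  occurs_at (spec_subst g f x) (tgd_head sim) (atom_pos (map_atom th a) (th x)).
Proof.
move=> ah xa.
exists (atom_pred (map_atom th a), unique_tuple (map (spec_subst g f) a.2)).
split=> //; first exact: (map_f (fun a => (atom_pred (map_atom th a), _))).
rewrite /atom_pos [_.2]/= -(@idx_map_eq _ _ _ (spec_subst g f)) //.
  exact/onth_unique_tuple/map_f.
by move=> u v ua va; apply: (spec_subst_eq gs fh); exact: mem_vars ah _.
Qed.

Lemma simulating_head_atP x p : occurs_at x (tgd_head sim) p ->
  exists a v, [/\ a \in tgd_head s, v \in a.2, x = spec_subst g f v &
    p = atom_pos (map_atom th a) (th v)].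
Proof.
case: p => R [|i] [b []]; rewrite //= => /mapP[a ah ->] /= <- _ E.
have : x \in map (spec_subst g f) a.2.
  by rewrite -mem_unique_tuple; apply/onthP; exists i.
move=> /mapP[v va xv]; exists a, v; split=> //; congr pair.
rewrite -(@idx_map_eq _ _ _ (spec_subst g f)) //.
  by rewrite -xv; exact: onth_unique_idx.
by move=> u w ua wa; apply: (spec_subst_eq gs fh); exact: mem_vars ah _.
Qed.

Lemma simulating_body_vars x :
  (x \in vars (tgd_body sim)) = (x \in map f g.2).
Proof. by rewrite /vars /= cats0 mem_unique_tuple. Qed.

Lemma simulating_head_varsP x : reflect
  (exists2 v, v \in vars (tgd_head s) & x = spec_subst g f v)
  (x \in vars (tgd_head sim)).
Proof.
apply: (iffP (varsP _ _)) => [[_ /mapP[a ah ->]]|[v /varsP[a ah va] ->]] /=.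
  rewrite mem_unique_tuple => /mapP[v va ->]; exists v => //.
  exact: mem_vars ah va.
exists (atom_pred (map_atom th a), unique_tuple (map (spec_subst g f) a.2)).
  exact: (map_f (fun a => (atom_pred (map_atom th a), _))).
by rewrite /= mem_unique_tuple map_f.
Qed.

Lemma spec_subst_mem v : (spec_subst g f v \in map f g.2) = (v \in g.2).
Proof.
rewrite /spec_subst; case: (boolP (v \in g.2)) => vg; first exact: map_f.
apply: contraNF vg => /mapP[u ug ->]; exact: (proj2 fh).
Qed.

Lemma simulating_frP x :
  reflect (exists2 y, y \in fr s & x = f y) (x \in fr sim).
Proof.
rewrite mem_fr simulating_body_vars.
apply: (iffP andP) => [[xf /simulating_head_varsP[v vh xv]]|[y yfr ->]].
  have vg : v \in g.2 by rewrite -spec_subst_mem -xv.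
  by exists v; rewrite ?head_var_fr // xv /spec_subst vg.
have yh : y \in vars (tgd_head s) by move: yfr; rewrite mem_fr => /andP[].
have yg : y \in g.2 by rewrite -head_var_fr.
split; first exact: map_f.
by apply/simulating_head_varsP; exists y; rewrite // /spec_subst yg.
Qed.

Lemma simulating_exvars v : v \in vars (tgd_head s) ->
  (spec_subst g f v \in exvars sim) = (v \notin fr s).
Proof.
move=> vh; rewrite mem_exvars simulating_body_vars spec_subst_mem -head_var_fr
  //.
by rewrite andbC; case: (boolP (v \in fr s)); rewrite ?andbF //= => _;
  apply/andP; split=> //; apply/simulating_head_varsP; exists v.
Qed.
End OneTrigger.

Lemma dg_node_atom_pos a t :
  sch S' (atom_pred a) -> t \in a.2 -> dg_node (@spred_ar _) S' (atom_pos a t).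
Proof.
by move=> Sa ta; split=> //; rewrite /spred_ar /= max_id_tuple idx_le_unique.
Qed.

Section Edges.
Variables (s : tgd P) (g : atom P var) (h : var -> term P) (a : atom P var).
Hypotheses (Ss : S s) (hC : hom (tgd_body s) C h) (gs : guard s = Some g).
Hypothesis ah : a \in tgd_head s.
Let al := map_atom h g.
Let be := map_atom (trigger_subst s h) a.

Lemma pred_step_trigger : pred_step S' (atom_pred al) (atom_pred be).
Proof.
have [f [fh S'sim]] := simulating_tgd_exists Ss hC gs.
have bb : (atom_pred al, unique_tuple (map f g.2)) \in
  tgd_body (simulating_tgd s g h f) by exact: mem_head.
have bh : (atom_pred be, unique_tuple (map (spec_subst g f) a.2)) \in
  tgd_head (simulating_tgd s g h f) by apply/mapP; exists a.
split; [exact: sch_body S'sim bb|exact: sch_head S'sim bh|right].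
by exists (simulating_tgd s g h f); split=> //;
  [exact: (map_f fst bb)|exact: (map_f fst bh)].
Qed.

(** Both kinds of edge at once: for a frontier variable [x] the edge is normal and must start at the
    same variable, otherwise it is special and may start at any frontier variable. *)
Lemma dg_edge_trigger x y : x \in a.2 -> y \in fr s ->
  (x \in fr s -> x = y) ->
  dg_edge (@spred_ar _) S' (atom_pos al (h y)) (x \notin fr s)
    (atom_pos be (trigger_subst s h x)).
Proof.
move=> xa yfr xy; have [gb gv] := guardP gs.
have yg : y \in g.2 by move: yfr; rewrite mem_fr => /andP[/gv].
have [Sal Sbe _] := pred_step_trigger.
have [f [fh S'sim]] := simulating_tgd_exists Ss hC gs.
split; [exact/dg_node_atom_pos/map_f|exact/dg_node_atom_pos/map_f|].
exists (simulating_tgd s g h f), (f y); split=> //.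
- by apply/(simulating_frP gs fh); exists y.
- exact: simulating_body_at.
have xh := mem_vars ah xa.
have at_x := simulating_head_at gs fh ah xa.
case: ifPn => [xfr|/negPn xfr].
  by exists (spec_subst g f x) => //; rewrite simulating_exvars.
by move: at_x; rewrite -[be]/be {1}/spec_subst -(head_var_fr gs xh) xfr xy.
Qed.
End Edges.
End Simulation.

(** * Infinite chase from a special cycle *)

Section Walk.
Variables (P : choiceType) (ar : P -> nat) (D : set (fact P)) (S : set (tgd P)).
Hypothesis ar_gt0 : forall p, 0 < ar p.
Hypotheses (finS : finite_set S) (wfS : forall s, S s -> wf_tgd ar s).
Hypotheses (wfD : forall a, D a -> wf_atom ar a).
Hypothesis guardedS : forall s, S s -> guarded s.
Let C := least_chase S (inst_of D).
Let S' := simple (lin ar S).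
Local Notation apred := (atom_pred D S).
Local Notation apos := (atom_pos D S).
Local Notation edge := (dg_edge (@spred_ar (stype P)) S').
Local Notation path := (dg_path (@spred_ar (stype P)) S').

Definition realizes (p : position (spred (stype P))) (t : term P) : Prop :=
  exists a, [/\ C a, sch S a.1, t \in a.2 & p = apos a t].

Lemma trigger_head s h a : S s -> hom (tgd_body s) C h -> a \in tgd_head s ->
  C (map_atom (trigger_subst s h) a) /\
  sch S (map_atom (trigger_subst s h) a).1.
Proof. by move=> Ss hC ah; split;
  [exact: Chase_step|exact: sch_head Ss ah]. Qed.

(** The TGD of the edge comes from a trigger on the realizing atom. A normal edge keeps the term; a
    special one starts at a frontier variable, so the null it leads to has the term as an
    argument. *)
Lemma realizes_edge p t b q : realizes p t -> edge p b q ->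
  exists2 u, realizes q u & depth t + b <= depth u.
Proof.
move=> [al [Cal Sal tal ->]] [_ _ [s' [x [S's' xfr xb xq]]]].
have [|s [g [h [f [Ss hC gs fh [alE s'E]]]]]] := simple_lin_simulating
    finS wfS wfD guardedS S's' Cal Sal.
  by move: xb => [c [cb /= <- _ _]]; exact: map_f.
subst s'; have [y [yg xy]] := simulating_body_atP fh xb.
rewrite -alE => /(congr1 snd) ty.
have {}ty : t = h y by apply: (@idx_inj _ al.2) => //; rewrite alE map_f.
have fr_val v : v \in vars (tgd_head s) -> x = spec_subst g f v ->
    v \in fr s /\ h v = t.
  move=> vh xv; have vg : v \in g.2.
    by rewrite -(spec_subst_mem fh) -xv xy map_f.
  split; first by rewrite (head_var_fr gs).
  by rewrite ty; apply/eqP; rewrite -(proj1 fh) // -xy xv /spec_subst vg.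
case: b xq => [[z zex zq]|xq].
  have [a [v [ah va zv ->]]] := simulating_head_atP gs fh zq.
  have vh := mem_vars ah va.
  move: zex; rewrite zv (simulating_exvars D S gs fh) // => vfr.
  exists (trigger_subst s h v).
    have [? ?] := trigger_head Ss hC ah.
    by exists (map_atom (trigger_subst s h) a); split=> //; exact: map_f.
  have [y' y'fr xy'] := simulating_frP D S gs fh _ xfr.
  have y'h : y' \in vars (tgd_head s) by move: y'fr; rewrite mem_fr => /andP[].
  have [_ <-] : y' \in fr s /\ h y' = t.
    by apply: fr_val => //; rewrite /spec_subst -(head_var_fr gs) // y'fr.
  by rewrite addn1 trigger_subst_Null //; apply/depth_Null_gt/map_f.
have [a [v [ah va xv ->]]] := simulating_head_atP gs fh xq.
have [vfr hv] := fr_val v (mem_vars ah va) xv.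
exists (trigger_subst s h v).
  have [? ?] := trigger_head Ss hC ah.
  by exists (map_atom (trigger_subst s h) a); split=> //; exact: map_f.
by rewrite trigger_subst_fr // hv addn0.
Qed.

Lemma realizes_path p t w : realizes p t -> path p w ->
  exists2 u, realizes (last p (map snd w)) u &
    depth t + count id (map fst w) <= depth u.
Proof.
elim: w p t => [|[b q] w IH] p t rt /=; first by exists t; rewrite ?addn0.
move=> [/(realizes_edge rt)[u ru le_u] /(IH q u ru)[v rv le_v]].
exists v => //; apply: leq_trans le_v; rewrite addnA leq_add2r.
by case: b le_u => /=.
Qed.

Lemma pred_step_realized a R : C a -> sch S a.1 -> pred_step S' (apred a) R ->
  exists b, [/\ C b, sch S b.1 & R = apred b].
Proof.
move=> Ca Sa [_ _ [<-|[s' [S's' ab Rh]]]]; first by exists a.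
have [s [g [h [f [Ss hC gs fh [aE s'E]]]]]] :=
  simple_lin_simulating finS wfS wfD guardedS S's' Ca Sa ab.
move: Rh; rewrite s'E -map_comp => /mapP[b bh ->].
by have [? ?] := trigger_head Ss hC bh; exists (map_atom (trigger_subst s h) b).
Qed.

Lemma pred_reach_realized a R : C a -> sch S a.1 -> pred_reach S' (apred a) R ->
  exists b, [/\ C b, sch S b.1 & R = apred b].
Proof.
move=> Ca Sa reach; move: reach (erefl (apred a)).
rewrite /pred_reach; move: {1 2}(apred a) => Q reach.
elim: reach a Ca Sa => {Q R} [Q R st|Q R T _ IH1 _ IH2] a Ca Sa E.
  by apply: (@pred_step_realized a) => //; rewrite -E.
have [b [Cb Sb Rb]] := IH1 a Ca Sa E.
by apply: (IH2 b).
Qed.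

Lemma simple_lin_db_pred a : simple_db (lin_db ar D S) a ->
  exists b, [/\ C b, sch S b.1 & a.1 = apred b].
Proof.
move=> [[tau t] lin_t <-]; have [R [_ [_ [[<- <-] DRt _ [gR _] _]]]] := lin_t.
have [SR ->] := (lin_db_typeP ar_gt0 finS wfS wfD tau DRt).1 (conj lin_t gR).
exists (ground (R, t)); split=> //.
  by apply: Chase_base; exists (R, t).
by congr pair; exact/esym/id_tuple_Const.
Qed.

Lemma path_nodesP p w n : path p w -> n \in path_nodes p w ->
  exists2 w', path n w' & last n (map snd w') = last p (map snd w).
Proof.
elim: w p => [|[b q] w IH] p /=; first by rewrite inE => _ /eqP->; exists [::].
move=> [e pw]; rewrite inE => /predU1P[->|]; first by exists ((b, q) :: w).
exact: IH.
Qed.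

Lemma depth_bounded (A : instance P) : finite_set A ->
  exists n, forall a t, A a -> t \in a.2 -> depth t <= n.
Proof.
move=> /finite_seqP[l ->]; exists (\max_(a <- l) \max_(t <- a.2) depth t).
move=> a t /= al ta; apply: leq_trans (leq_bigmax_seq a al isT).
exact: leq_bigmax_seq.
Qed.

Lemma finite_chase_weakly_acyclic : finite_set C ->
  weakly_acyclic (@spred_ar (stype P)) (simple_db (lin_db ar D S)) S'.
Proof.
move=> /depth_bounded[N depthN] [p [w [pw cyc spec [a [n
  [/simple_lin_db_pred]]]]]].
move=> [b [Cb Sb ->]] nw /(pred_reach_realized Cb Sb){b Cb Sb}[b [Cb Sb nb]].
(* Only a genuine position has a term. [n] has an outgoing edge: if nothing of the cycle follows it,
   then [n] is [p], where the cycle starts. *)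
have node_n : dg_node (@spred_ar _) S' n.
  have [w' pw' last_w'] := path_nodesP pw nw.
  case: w' pw' last_w' => [_ /= ->|[c q] w' [[]]//].
  by rewrite cyc; case: w pw spec {cyc nw} => // -[c q] w [[]].
have [t rt] : exists t, realizes n t.
  have [_ /andP[i0 iN]] := node_n; move: iN;
    rewrite /spred_ar nb max_id_tuple => iN.
  pose t := nth (Const 0) (unique_tuple b.2) n.2.-1.
  have iN' : n.2.-1 < size (unique_tuple b.2) by rewrite prednK.
  exists t, b; split=> //; first by rewrite -mem_unique_tuple mem_nth.
  rewrite [LHS]surjective_pairing nb; congr pair.
  by rewrite /idx index_uniq ?unique_tuple_uniq // prednK.
have [w' pw' last_w'] := path_nodesP pw nw.
have [u ru _] := realizes_path rt pw'; rewrite last_w' cyc in ru.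
have loop k : exists2 v, realizes p v & k <= depth v.
  elim: k => [|k [v rv kv]]; first by exists u.
  have [v' rv' le_v'] := realizes_path rv pw; rewrite cyc in rv'.
  exists v' => //; apply: leq_trans le_v'; rewrite -addn1 leq_add //.
  by rewrite -has_count; apply/hasP; exists true.
have [v [c [Cc _ vc _]] lt_v] := loop N.+1.
by have := depthN c v Cc vc; rewrite leqNgt lt_v.
Qed.
End Walk.

(** * Depth bound from weak acyclicity *)

Fixpoint words (T : Type) (k : nat) (l : seq T) : seq (seq T) :=
  if k is k'.+1 then [seq x :: u | x <- l, u <- words k' l] else [:: [::]].

Lemma size_words (T : Type) k (l : seq T) : size (words k l) = size l ^ k.
Proof. by elim: k => //= k IH; rewrite size_allpairs IH expnS. Qed.

Lemma mem_words (T : eqType) (l u : seq T) :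
  {subset u <= l} -> u \in words (size u) l.
Proof.
elim: u => [//|x u IH] sub; apply/allpairsP; exists (x, u); split=> //=.
  exact/sub/mem_head.
by apply: IH => y yu; apply: sub; rewrite in_cons yu orbT.
Qed.

Fixpoint subseqs (T : Type) (l : seq T) : seq (seq T) :=
  if l is x :: l' then subseqs l' ++ map (cons x) (subseqs l') else [:: [::]].

Lemma size_subseqs (T : Type) (l : seq T) : size (subseqs l) = 2 ^ size l.
Proof. by elim: l => //= x l IH;
  rewrite size_cat size_map IH expnS mul2n addnn. Qed.

(** Every subset of a list arises by filtering, so [subseqs] enumerates the possible second
    components of types. *)
Lemma filter_subseqs (T : eqType) (l : seq T) (p : pred T) :
  [seq x <- l | p x] \in subseqs l.
Proof.
elim: l => //= x l IH; rewrite mem_cat; case: ifP => _; last by rewrite IH.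
by rewrite map_f ?orbT.
Qed.

Lemma max_ar_gt0 (P : choiceType) (ar : P -> nat) (S : set (tgd P)) p :
  (forall p, 0 < ar p) -> finite_set S -> sch S p -> 0 < max_ar ar S.
Proof. by move=> ar0 fS Sp; apply: leq_trans (@leq_max_ar _ ar _ _ fS Sp). Qed.

Section AtomsOver.
Variables (P : choiceType) (ar : P -> nat) (S : set (tgd P)).
Hypotheses (ar_gt0 : forall p, 0 < ar p) (finS : finite_set S).

Definition sch_seq : seq P := fset_set (sch S).

Lemma mem_sch_seq p : (p \in sch_seq) = (p \in sch S).
Proof. by rewrite in_fset_set //; exact: finite_sch. Qed.

Definition atoms_over (T : Type) (l : seq T) : seq (atom P T) :=
  flatten [seq [seq (p, u) | u <- words (ar p) l] | p <- sch_seq].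

Lemma mem_atoms_over (T : eqType) (l : seq T) (a : atom P T) :
  sch S a.1 -> wf_atom ar a -> {subset a.2 <= l} -> a \in atoms_over l.
Proof.
move=> Sa wa al; apply/flattenP; exists [seq (a.1, u) | u <- words (ar a.1) l].
  by apply: (map_f (fun p => [seq (p, u) | u <- words (ar p) l]));
    rewrite mem_sch_seq inE.
by rewrite [a in a \in _]surjective_pairing map_f // -wa mem_words.
Qed.

Lemma size_atoms_over (T : Type) (l : seq T) w : size l <= w -> 0 < w ->
  size (atoms_over l) <= ncard (sch S) * w ^ max_ar ar S.
Proof.
move=> lw w0; rewrite size_flatten /shape -map_comp sumnE big_map.
apply: leq_trans (_ : \sum_(p <- sch_seq) w ^ max_ar ar S <= _).
  rewrite big_seq [leqRHS]big_seq; apply: leq_sum => p;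
    rewrite mem_sch_seq inE => Sp.
  rewrite /= size_map size_words; apply: (@leq_trans (w ^ ar p));
    first by rewrite leq_exp2r.
  by rewrite leq_pexp2l // leq_max_ar.
by rewrite big_const_seq count_predT iter_addn addn0 mulnC.
Qed.
End AtomsOver.

Section Depth.
Variables (P : choiceType) (ar : P -> nat) (D : set (fact P)) (S : set (tgd P)).
Hypothesis ar_gt0 : forall p, 0 < ar p.
Hypotheses (finS : finite_set S) (wfS : forall s, S s -> wf_tgd ar s).
Hypotheses (wfD : forall a, D a -> wf_atom ar a).
Hypothesis guardedS : forall s, S s -> guarded s.
Let C := least_chase S (inst_of D).
Let S' := simple (lin ar S).
Let D' := simple_db (lin_db ar D S).
Local Notation apred := (atom_pred D S).
Local Notation apos := (atom_pos D S).
Local Notation edge := (dg_edge (@spred_ar (stype P)) S').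
Local Notation path := (dg_path (@spred_ar (stype P)) S').

Lemma dg_path_rcons p w b q :
  path p w -> edge (last p (map snd w)) b q -> path p (rcons w (b, q)).
Proof. by elim: w p => [|[c r] w IH] p //= [e /IH{}IH] /IH. Qed.

(** Shows that a cycle through the position of a chase atom is supported, as is needed to apply weak
    acyclicity. *)
Lemma chase_supported a : C a -> sch S a.1 ->
  exists2 d, D' d & d.1 = apred a \/ pred_reach S' d.1 (apred a).
Proof.
elim=> {a} [_ [[R t] DRt <-] Sa|s h a Ss hC IH ah _].
  exists (simple_atom (atom_type S C (ground (R, t)), t)).
    exists (atom_type S C (ground (R, t)), t) => //.
    by have [] := (lin_db_typeP ar_gt0 finS wfS wfD
      (atom_type S C (ground (R, t))) DRt).2 (conj Sa erefl).
  by left; congr pair; exact/esym/id_tuple_Const.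
have [g gs] := guarded_guard (guardedS Ss); have [gb _] := guardP gs.
have [d D'd dg] := IH g gb (sch_body Ss gb).
exists d => //; right.
have st := pred_step_trigger ar_gt0 finS wfS wfD guardedS Ss hC gs ah.
by case: dg => [->|dg]; [exact: t_step|apply: t_trans dg _; exact: t_step].
Qed.

Definition chase_nodes (n : position (spred (stype P))) : Prop :=
  exists t, realizes D S n t.

(* Each null yields a node that the nodes of its arguments reach through a
   special edge; weak acyclicity makes it distinct from all of them. *)
Lemma chase_distinct_nodes a t :
  weakly_acyclic (@spred_ar (stype P)) D' S' -> C a -> sch S a.1 -> t \in a.2 ->
  exists ns : seq (position (spred (stype P))),
    [/\ uniq ns, size ns = depth t & {in ns, forall n, chase_nodes n /\
      exists2 w, path n w & last n (map snd w) = apos a t}].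
Proof.
move=> WA Ca; elim: Ca t => {a} [a Ia|s h a Ss hC IH ah] t Sa ta.
  by have [c ->] := inst_of_const Ia ta; exists [::].
have [g gs] := guarded_guard (guardedS Ss); have [gb gv] := guardP gs.
have edges := dg_edge_trigger ar_gt0 finS wfS wfD guardedS Ss hC gs ah.
have [Ca _] := trigger_head Ss hC ah.
have node u : u \in (map_atom (trigger_subst s h) a).2 ->
    chase_nodes (apos (map_atom (trigger_subst s h) a) u).
  by move=> ua; exists u, (map_atom (trigger_subst s h) a).
have /mapP[x xa tx] := ta; have node_t := node t ta;
  rewrite {}tx in ta node_t *.
(* Used with [y = x] and a normal edge for a frontier variable, and with a deepest frontier value
   and a special edge for a null. *)
have step y b : y \in fr s -> (x \in fr s -> x = y) -> b = (x \notin fr s) ->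
    exists ns : seq (position (spred (stype P))),
    [/\ uniq ns, size ns = depth (h y) & {in ns, forall n, chase_nodes n /\
      exists w, path n (rcons w (b, apos (map_atom (trigger_subst s h) a)
        (trigger_subst s h x)))}].
  move=> yfr xy ->; have e := edges x y xa yfr xy.
  have yg : h y \in (map_atom h g).2.
    by apply/map_f/gv; move: yfr; rewrite mem_fr => /andP[].
  have [ns [un sz nsP]] := IH g gb (h y) (sch_body Ss gb) yg.
  exists ns; split=> // n /nsP[good [w pw wl]]; split=> //; exists w.
  by apply: dg_path_rcons; rewrite // wl.
case: (boolP (x \in fr s)) => xfr.
  have [//|ns [un sz nsP]] := @step x false xfr (fun=> erefl);
    first by rewrite xfr.
  exists ns; split=> //; first by rewrite sz trigger_subst_fr.
  move=> n /nsP[good [w pw]].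
  split=> //; eexists; first exact: pw.
  by rewrite map_rcons last_rcons.
(* A null with empty frontier has depth 1, and its own position is the single node required. *)
case: (depth_argsP [seq h y | y <- fr s]) => [us0|[_ /mapP[y yfr ->] dy]].
  exists [:: apos (map_atom (trigger_subst s h) a) (trigger_subst s h x)].
  split=> //; first by rewrite trigger_subst_Null //= us0 big_nil.
  by move=> n; rewrite inE => /eqP->; split=> //; exists [::].
have [||ns [un sz nsP]] := @step y true yfr; first by rewrite (negbTE xfr).
  by rewrite xfr.
set n0 := apos _ _ in node_t nsP *.
have pathP n w : path n (rcons w (true, n0)) -> last n (map snd (rcons w (true,
  n0))) = n0.
  by rewrite map_rcons last_rcons.
exists (n0 :: ns); split=> /=.
(* If the node of the null were already listed, the path from it to itself would close a supported
   cycle whose last edge is special. *)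
- rewrite un andbT; apply/negP => /nsP[_ [w pw]]; apply: WA;
    exists n0, (rcons w (true, n0)).
  split=> //; [exact: (pathP _ _ pw)|by rewrite map_rcons mem_rcons mem_head|].
  have [d D'd dP] := chase_supported Ca Sa.
  exists d, n0; split=> //; first exact: mem_head.
  case: dP => // ->; apply: t_step.
  have Sn0 : sch S' n0.1.
    have := edges x y xa yfr;
      rewrite (negbTE xfr) => /(_ (fun e => False_ind _ (notF e))).
    by case=> _ [].
  by split=> //; left.
- by rewrite sz trigger_subst_Null //= dy.
move=> n; rewrite in_cons => /predU1P[->|/nsP[good [w pw]]].
  by split=> //; exists [::].
by split=> //; exists (rcons w (true, n0)) => //; exact: pathP pw.
Qed.

(** With n predicates and maximal arity m there are at most n m^m renamed atoms. A realized node is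
    a type (one of these atoms as guard, a set of them as the rest), the pattern, which is the tuple
    of the guard, and one of m indices: at most n m^m 2^(n m^m) m nodes, and this is at most d. *)
Lemma chase_nodes_bound p : sch S p ->
  exists2 ns, size ns <= depth_bound ar S & forall n, chase_nodes n -> n \in ns.
Proof.
move=> Sp; pose m := max_ar ar S.
have m0 : 0 < m := max_ar_gt0 ar_gt0 finS Sp.
pose L := atoms_over ar S (iota 1 m).
pose taus := [seq (al, [set` T]) : stype P | al <- L, T <- subseqs L].
exists [seq ((tau, tau.1.2), i) | tau <- taus, i <- iota 1 m].
  rewrite !size_allpairs size_iota size_subseqs /depth_bound -/m.
  have szL : size L <= ncard (sch S) * m ^ m.
    by apply: size_atoms_over; rewrite ?size_iota.
  rewrite mulnAC; apply: leq_mul; last by rewrite leq_pexp2l.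
  apply: (@leq_trans (ncard (sch S) * m ^ m * m));
    first by rewrite leq_mul2r szL orbT.
  by rewrite -mulnA -expnSr leq_mul2l leq_pexp2l ?orbT // addn1 ltnS mul2n
    -addnn leq_addr.
move=> _ [t [a [Ca Sa ta ->]]].
have wf b : C b -> wf_atom ar b by exact: chase_wf.
have idx_m b c : C b -> sch S b.1 -> c \in b.2 -> idx b.2 c \in iota 1 m.
  move=> Cb Sb cb; rewrite mem_iota add1n ltnS idx_gt0 /=.
  by apply: leq_trans (idx_le cb) _; rewrite wf //; exact: leq_max_ar.
have rho_L b : C b -> sch S b.1 -> dom b `<=` dom a -> map_atom (idx a.2) b \in
  L.
  move=> Cb Sb ba; apply: mem_atoms_over => //;
    first by rewrite /wf_atom /= size_map wf.
  by move=> _ /mapP[c /ba ca ->]; exact: idx_m.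
apply/allpairsP; exists (atom_type S C a, idx a.2 t); split=> //=;
  last exact: idx_m.
apply/allpairsP; exists (map_atom (idx a.2) a, [seq b <- L | `[< (atom_type S C
  a).2 b >]]).
split; [exact: rho_L|exact: filter_subseqs|].
congr pair; apply/seteqP; split=> b /=; rewrite mem_filter.
  move=> bT; apply/andP; split; first exact/asboolP.
  by case: bT => c [[Cc Sc ca] _] <-; exact: rho_L.
by move=> /andP[/asboolP].
Qed.

Lemma weakly_acyclic_depth a t :
  weakly_acyclic (@spred_ar (stype P)) D' S' -> C a -> t \in a.2 ->
  depth t <= depth_bound ar S.
Proof.
move=> WA Ca ta; case: (least_chase_sch Ca) => [Ia|Sa].
  by have [c ->] := inst_of_const Ia ta.
have [ns [un <- nsP]] := chase_distinct_nodes WA Ca Sa ta.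
have [L szL mem_L] := chase_nodes_bound Sa.
by apply: leq_trans szL; apply: uniq_leq_size => // n /nsP[/mem_L].
Qed.
End Depth.

(** * Size of a chase of bounded depth *)

Lemma card_le_seq (T : choiceType) (A : set T) (l : seq T) n :
  A `<=` [set` l] -> size l <= n -> A #<= `I_n.
Proof.
move=> Al ln; have finA : finite_set A := sub_finite_set Al (finite_seq l).
have [k Ak] := finA; have /card_eqPle[A_le _] := Ak.
apply: card_le_trans A_le _; rewrite card_le_II -(card_fset_set Ak).
apply: leq_trans ln; apply: uniq_leq_size; first exact: fset_uniq.
by move=> x; rewrite in_fset_set // inE => /Al.
Qed.

Section Counting.
Variables (P : choiceType) (ar : P -> nat) (D : set (fact P)) (S : set (tgd P)).
Hypothesis ar_gt0 : forall p, 0 < ar p.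
Hypotheses (dbD : database ar D) (tgdS : tgd_set ar S).
Hypothesis guardedS : forall s, S s -> guarded s.
Let C := least_chase S (inst_of D).
Let finS : finite_set S. Proof. by case: tgdS. Qed.
Let wfS s : S s -> wf_tgd ar s. Proof. by case: tgdS => _ /(_ s). Qed.
Let finD : finite_set D. Proof. by case: dbD. Qed.
Let wfD a : D a -> wf_atom ar a. Proof. by case: dbD => _ /(_ a). Qed.
Let atom_seq : seq (atom P var) := fset_set (atoms S).
Let tgd_seq : seq (tgd P) := fset_set S.
Let fact_seq : seq (fact P) := fset_set D.
Let width := ncard (atoms S) * max_ar ar S.

Lemma finite_atoms : finite_set (atoms S).
Proof. by apply: bigcup_finite => // s _; exact: finite_seq. Qed.

Lemma mem_atom_seq s a : S s -> a \in tgd_atoms s -> a \in atom_seq.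
Proof.
move=> Ss sa; rewrite in_fset_set; last exact: finite_atoms.
by rewrite inE; exists s.
Qed.

Lemma atom_seqP a : a \in atom_seq -> sch S a.1 /\ wf_atom ar a.
Proof.
rewrite in_fset_set; last exact: finite_atoms.
rewrite inE => -[s Ss sa]; split; first by exists a => //; exists s.
by have [_ _] := wfS Ss; exact.
Qed.

Lemma mem_tgd_seq s : (s \in tgd_seq) = (s \in S).
Proof. by rewrite in_fset_set. Qed.

Lemma mem_fact_seq a : (a \in fact_seq) = (a \in D).
Proof. by rewrite in_fset_set. Qed.

(** Atoms have variables because arities are positive, and distinct TGDs share none, so their first
    body atoms are distinct. *)
Lemma size_tgd_seq : size tgd_seq <= ncard (atoms S).
Proof.
pose first (s : tgd P) := ohead (tgd_body s).
have firstP s : S s -> exists2 a, a \in tgd_body s & first s = Some a.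
  move=> /wfS[]; rewrite /first; case: (tgd_body s) => // a l _ _ _.
  by exists a; rewrite ?mem_head.
have inj : {in tgd_seq &, injective first}.
  move=> s s'; rewrite !mem_tgd_seq !inE => Ss Ss' E.
  have [a sa ea] := firstP s Ss; have [b sb eb] := firstP s' Ss'.
  have ab : a = b by move: E; rewrite ea eb => -[].
  have sz : 0 < size a.2.
    by have [_ _ /(_ a)->] := wfS Ss; rewrite /tgd_atoms ?mem_cat ?sa.
  have [_ _ disj] := tgdS.
  apply: (disj s s' (nth 0 a.2 0)) => //.
    by apply: (mem_vars _ (mem_nth 0 sz)); rewrite mem_cat sa.
  by apply: (mem_vars _ (mem_nth 0 sz)); rewrite ab mem_cat sb.
rewrite -(size_map first) -(size_map Some atom_seq : _ = ncard _).
apply: uniq_leq_size; first by rewrite map_inj_in_uniq // fset_uniq.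
move=> _ /mapP[s + ->]; rewrite mem_tgd_seq inE => Ss.
have [a sa ->] := firstP s Ss.
by apply: map_f; apply: (mem_atom_seq Ss); rewrite mem_cat sa.
Qed.

Definition child_bag (s : tgd P) (us : seq (term P)) : seq (term P) :=
  us ++ [seq Null s z us | z <- exvars s].

(* Every atom of depth [i] has its terms in a bag of level [i]: a fact of [D] if
   [i = 0], and otherwise the frontier values and the new nulls of a trigger. *)
Fixpoint bags (i : nat) : seq (seq (term P)) :=
  if i is j.+1 then
    flatten [seq flatten [seq [seq child_bag s us | us <- words (size (fr s)) b]
                         | s <- tgd_seq] | b <- bags j]
  else [seq (ground a).2 | a <- fact_seq & a.1 \in sch_seq S].

Lemma mem_bagsS j b s us : b \in bags j -> S s -> size us = size (fr s) ->
  {subset us <= b} -> child_bag s us \in bags j.+1.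
Proof.
move=> bj Ss sz usb; apply/flattenP.
exists (flatten [seq [seq child_bag s us | us <- words (size (fr s)) b] | s <-
  tgd_seq]).
  exact: (map_f (fun b => flatten [seq [seq child_bag s us | us <- words (size
    (fr s)) b] | s <- tgd_seq])).
apply/flattenP; exists [seq child_bag s us | us <- words (size (fr s)) b].
  apply: (map_f (fun s => [seq child_bag s us | us <- words (size (fr s)) b])).
  by rewrite mem_tgd_seq inE.
by apply: map_f; rewrite -sz mem_words.
Qed.

Lemma mem_bagsSP j b' : b' \in bags j.+1 -> exists b s us,
  [/\ b \in bags j, S s, us \in words (size (fr s)) b & b' = child_bag s us].
Proof.
move=> /flattenP[_ /mapP[b bj ->] /flattenP[_ /mapP[s sS ->] /mapP[us usb ->]]].
by exists b, s, us; split=> //; move: sS; rewrite mem_tgd_seq inE.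
Qed.

Lemma words_sub (T : eqType) k (l u : seq T) :
  u \in words k l -> size u = k /\ {subset u <= l}.
Proof.
elim: k u => [|k IH] u /=; first by rewrite inE => /eqP->.
move=> /allpairsP[[x v] /= [xl /IH[<- vl] ->]]; split=> // y.
by rewrite in_cons => /predU1P[->|/vl].
Qed.

Lemma bags_depth j b : b \in bags j -> {in b, forall t, depth t <= j}.
Proof.
elim: j b => [|j IH] b; first by move=> /mapP[a _ ->] _ /mapP[c _ ->].
move=> /mem_bagsSP[c [s [us [cj _ /words_sub[_ usc] ->]]]] t.
rewrite mem_cat => /orP[/usc/(IH c cj)|/mapP[z _ ->]]; first exact: leqW.
rewrite /= ltnS big_map; apply/bigmax_leqP_seq => u /usc uc _.
exact: IH uc.
Qed.

(** The frontier and existential variables of a TGD are distinct variables of Sigma, and the atoms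
    of Sigma have at most [width] variable occurrences. *)
Lemma bags_width p j b : sch S p -> b \in bags j -> size b <= width.
Proof.
move=> Sp; have wid_gt0 : 0 < ncard (atoms S).
  case: Sp => a [s Ss sa] _; apply: leq_trans size_tgd_seq.
  have : s \in tgd_seq by rewrite mem_tgd_seq inE.
  by case: tgd_seq.
case: j => [|j].
  move=> /mapP[a]; rewrite mem_filter mem_sch_seq // mem_fact_seq.
  move=> /andP[/set_mem Sa /set_mem/wfD wa] ->; rewrite size_map wa.
  by apply: leq_trans (leq_pmull _ wid_gt0); exact: leq_max_ar.
move=> /mem_bagsSP[c [s [us [_ Ss /words_sub[sz _] ->]]]].
rewrite size_cat sz size_map -size_cat.
apply: (@leq_trans (size (vars atom_seq))).
  apply: uniq_leq_size.
    rewrite cat_uniq !filter_uniq ?undup_uniq // andbT.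
    apply/hasPn => x; rewrite mem_exvars mem_fr => /andP[/negbTE->].
    by [].
  have sub x : x \in vars (tgd_head s) -> x \in vars atom_seq.
    move=> /varsP[a ah xa]; apply: mem_vars xa.
    by apply: (mem_atom_seq Ss); rewrite mem_cat ah orbT.
  by move=> x; rewrite mem_cat mem_exvars mem_fr => /orP[]/andP[_ /sub].
rewrite size_flatten /shape -map_comp sumnE big_map /width.
apply: (@leq_trans (\sum_(a <- atom_seq) max_ar ar S)).
  rewrite big_seq [leqRHS]big_seq; apply: leq_sum => a /atom_seqP[Sa wa] /=.
  by rewrite wa; exact: leq_max_ar.
by rewrite big_const_seq count_predT iter_addn addn0 mulnC.
Qed.

(** Passing to the guard of a trigger preserves only frontier values, hence the sublist [V]. If [V]
    has a new null, the frontier values are less deep and lie in an earlier bag, whose child bag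
    contains the whole atom; otherwise [V] consists of terms of the guard. *)
Lemma chase_in_bag a (V : seq (term P)) i : C a -> sch S a.1 ->
  {subset V <= a.2} -> {in V, forall t, depth t <= i} ->
  exists j b, [/\ j <= i, b \in bags j & {subset V <= b}].
Proof.
move=> Ca; elim: Ca V i => {a} [_ [a Da <-]|s h a Ss hC IH ah] V i Sa Va Vi.
  exists 0, (ground a).2; split=> //.
  apply: (map_f (fun a => (ground a).2)).
  by rewrite mem_filter mem_sch_seq // mem_fact_seq !mem_set.
have [g gs] := guarded_guard (guardedS Ss); have [gb gv] := guardP gs.
pose us := [seq h y | y <- fr s].
have us_g : {subset us <= (map_atom h g).2}.
  by move=> _ /mapP[y + ->]; rewrite mem_fr => /andP[/gv yg _]; exact: map_f.
case: (boolP (has (fun x => (x \notin fr s) && (trigger_subst s h x \in V))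
  a.2)).
  move=> /hasP[x xa /andP[xfr /Vi]]; rewrite trigger_subst_Null // -/us.
  set k := \max_(n <- [seq depth u | u <- us]) n; rewrite [depth _]/= -/k => ki.
  have us_k : {in us, forall t, depth t <= k} by move=> t /leq_depth_args.
  have [j [b [jk bj usb]]] := IH g gb us k (sch_body Ss gb) us_g us_k.
  have jE : j = k.
    apply/eqP; rewrite eqn_leq jk /=.
    by apply/bigmax_leqP_seq => _ /mapP[u uus ->] _; apply/(bags_depth bj)/usb.
  exists k.+1, (child_bag s us); split=> //.
    by apply: (@mem_bagsS k b); rewrite -?jE // size_map.
  move=> t tV; have /mapP[z za ->] := Va t tV; rewrite mem_cat.
  case: (boolP (z \in fr s)) => zfr; first by rewrite trigger_subst_fr // map_f.
  rewrite trigger_subst_Null //; apply/orP; right.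
  apply: (map_f (fun z => Null s z us)); have zh := mem_vars ah za.
  by move: zfr; rewrite mem_fr mem_exvars zh andbT => ->.
move=> /hasPn Vfr; apply: (IH g gb) (sch_body Ss gb) _ Vi => t tV; apply: us_g.
have /mapP[z za tE] := Va t tV; rewrite tE in tV *.
have := Vfr z za; rewrite tV andbT negbK => zfr.
by rewrite trigger_subst_fr // map_f.
Qed.

(** A child of a bag is given by a TGD and a word over the bag, whose length is the size of the
    frontier and thus at most the arity of the guard. *)
Lemma size_bags j w : (forall i b, b \in bags i -> size b <= w) -> 0 < w ->
  size (bags j) <= size (bags 0) * (ncard (atoms S) * w ^ max_ar ar S) ^ j.
Proof.
move=> bw w0; elim: j => [|j IH]; first by rewrite muln1.
rewrite expnSr mulnA; apply: leq_trans (leq_mul IH (leqnn _)).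
rewrite [bags j.+1]/= size_flatten /shape -map_comp sumnE big_map.
apply: (@leq_trans (\sum_(b <- bags j) ncard (atoms S) * w ^ max_ar ar S));
  last first.
  by rewrite big_const_seq count_predT iter_addn addn0 mulnC.
rewrite big_seq [leqRHS]big_seq; apply: leq_sum => b bj /=.
rewrite size_flatten /shape -map_comp sumnE big_map.
apply: (@leq_trans (\sum_(s <- tgd_seq) w ^ max_ar ar S)); last first.
  rewrite big_const_seq count_predT iter_addn addn0 mulnC leq_mul2r.
  by rewrite size_tgd_seq orbT.
rewrite big_seq [leqRHS]big_seq; apply: leq_sum => s /=.
rewrite mem_tgd_seq inE => Ss; rewrite size_map size_words.
have [g gs] := guarded_guard (guardedS Ss); have [gb gv] := guardP gs.
have fr_ar : size (fr s) <= max_ar ar S.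
  apply: leq_trans (@leq_max_ar _ ar _ _ finS (sch_body Ss gb)).
  have [_ _ /(_ g) <-] := wfS Ss; last by rewrite mem_cat gb.
  apply: uniq_leq_size; first by rewrite filter_uniq ?undup_uniq.
  by move=> x; rewrite mem_fr => /andP[/gv].
apply: (@leq_trans (w ^ size (fr s))); last by rewrite leq_pexp2l.
by case: (size (fr s)) => // k; rewrite leq_exp2r // (bw j).
Qed.

Lemma size_bags0 : size (bags 0) <= count (fun a => a.1 \in sch_seq S) fact_seq.
Proof. by rewrite size_map size_filter. Qed.

(** With A atoms, n predicates, maximal arity m and N = A n m, a bag of at most A m terms has at
    most A (A m)^m <= N^(2m) children and n (A m)^m <= N^m atoms over it. In the exponent 2m(d + 1),
    up to d factors N^(2m) account for the generations and one for the atoms; the factor d + 1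
    counts the levels. *)
Lemma chase_bound d : (forall a t, C a -> t \in a.2 -> depth t <= d) ->
  C #<= `I_(ncard D * ((d + 1) * tnorm ar S ^ (2 * max_ar ar S * (d + 1)))).
Proof.
move=> Cd; case: (pselect (exists p, sch S p)) => [[p Sp]|nS]; last first.
  apply: (@card_le_seq _ _ [seq ground a | a <- fact_seq]).
    move=> a /least_chase_sch[[b Db <-]|Sa]; last by case: nS; exists a.1.
    by apply: map_f; rewrite mem_fact_seq mem_set.
  (* Without predicates in Sigma the exponent vanishes, and the zeroth power being 1 keeps the bound
     above the number of facts. *)
  have -> : max_ar ar S = 0.
    rewrite /max_ar big1_seq // => p; rewrite in_fset_set ?inE;
      last exact: finite_sch.
    by move=> Sp; case: nS; exists p.
  by rewrite size_map muln0 mul0n expn0 muln1 leq_pmulr // addn1.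
set n := ncard (sch S); set m := max_ar ar S; set A := ncard (atoms S).
have m0 : 0 < m := max_ar_gt0 ar_gt0 finS Sp.
have n0 : 0 < n.
  have : p \in sch_seq S by rewrite mem_sch_seq // inE.
  by rewrite /n /ncard -/(sch_seq S); case: sch_seq.
have A0 : 0 < A.
  case: Sp => a [s Ss sa] _; apply: leq_trans size_tgd_seq.
  have : s \in tgd_seq by rewrite mem_tgd_seq inE.
  by case: tgd_seq.
have w0 : 0 < width by rewrite muln_gt0 A0.
have bw i b : b \in bags i -> size b <= width by exact: bags_width Sp.
(* Facts with predicates foreign to Sigma take part in no trigger and have no bag; they are counted
   separately and added back at the end. *)
pose foreign := [seq ground a | a <- fact_seq & a.1 \notin sch_seq S].
pose level i := flatten [seq atoms_over ar S b | b <- bags i].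
apply: (@card_le_seq _ _ (foreign ++ flatten [seq level i | i <- iota 0 (d +
  1)])).
  move=> a Ca /=; rewrite mem_cat; case: (pselect (sch S a.1)) => [Sa|nSa];
    last first.
    have [[b Db ba]|//] := least_chase_sch Ca; rewrite -ba; apply/orP; left.
    apply: map_f; rewrite mem_filter mem_sch_seq // mem_fact_seq (mem_set Db)
      andbT.
    by apply/negP => /set_mem Sb; apply: nSa; rewrite -ba.
  have [t ta|j [b [jd bj ab]]] := @chase_in_bag a a.2 d Ca Sa (fun x => id) _.
    exact: Cd Ca ta.
  apply/orP; right; apply/flattenP; exists (level j).
    by apply: map_f; rewrite mem_iota /= add0n addn1 ltnS.
  apply/flattenP; exists (atoms_over ar S b); first exact: map_f.
  by apply: mem_atoms_over => //; exact: chase_wf Ca.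
set N := tnorm ar S.
have NE : N = A * n * m by [].
have N0 : 0 < N by rewrite NE !muln_gt0 A0 n0.
have nW : n * width ^ m <= N ^ m.
  apply: (@leq_trans (n ^ m * width ^ m)).
    by rewrite leq_mul2r; apply/orP; right; rewrite -{1}(expn1 n) leq_pexp2l.
  by rewrite -expnMn /width NE mulnA (mulnC n).
have AW : A * width ^ m <= N ^ (2 * m).
  apply: (@leq_trans (N * N ^ m)).
    apply: leq_mul; first by rewrite NE -mulnA leq_pmulr // muln_gt0 n0.
    by apply: leq_trans nW; rewrite leq_pmull.
  by rewrite -expnS leq_pexp2l // mul2n -addnn -add1n leq_add2r.
have lev i : i <= d -> size (level i) <= size (bags 0) * N ^ (2 * m * (d + 1)).
  move=> id; apply: (@leq_trans (size (bags i) * (n * width ^ m))).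
    rewrite size_flatten /shape -map_comp sumnE big_map.
    apply: (@leq_trans (\sum_(b <- bags i) n * width ^ m)); last first.
      by rewrite big_const_seq count_predT iter_addn addn0 mulnC.
    rewrite big_seq [leqRHS]big_seq; apply: leq_sum => b /bw bi /=.
    exact: size_atoms_over.
  apply: leq_trans (leq_mul (size_bags i bw w0) (leqnn _)) _.
  rewrite -mulnA leq_mul2l; apply/orP; right.
  rewrite addn1 mulnSr expnD; apply: leq_mul.
    rewrite (expnM N); apply: (@leq_trans ((N ^ (2 * m)) ^ i)).
      by case: i id => // i _; rewrite leq_exp2r.
    by rewrite leq_pexp2l // expn_gt0 N0.
  by apply: leq_trans nW _; rewrite leq_pexp2l // leq_pmull.
rewrite size_cat size_map size_filter; set R := N ^ _ in lev *.
have R0 : 0 < R by rewrite expn_gt0 N0.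
apply: (@leq_trans (
  count (fun a => a.1 \notin sch_seq S) fact_seq * ((d + 1) * R)
  + count (fun a => a.1 \in sch_seq S) fact_seq * ((d + 1) * R))).
  apply: leq_add; first by rewrite leq_pmulr // muln_gt0 addn1.
  rewrite size_flatten /shape -map_comp sumnE big_map.
  apply: (@leq_trans (\sum_(i <- iota 0 (d + 1)) size (bags 0) * R)).
    rewrite big_seq [leqRHS]big_seq; apply: leq_sum => i /=.
    by rewrite mem_iota /= add0n addn1 ltnS => /lev.
  rewrite big_const_seq count_predT iter_addn addn0 size_iota mulnAC mulnA.
  by rewrite -!mulnA leq_mul ?size_bags0 // mulnC.
rewrite -mulnDl leq_mul2r.
apply/orP; right; apply/eq_leq; rewrite [LHS]addnC.
exact: (count_predC (fun a => a.1 \in sch_seq S) fact_seq).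
Qed.
End Counting.

Theorem theorem8p3 (P : choiceType) (ar : P -> nat)
    (ar_gt0 : forall p, 0 < ar p)
    (D : set (fact P)) (Sigma : set (tgd P))
    (dbD : database ar D) (tgdS : tgd_set ar Sigma)
    (guardedS : forall s, Sigma s -> guarded s) :
  (CT D Sigma <-> chase D Sigma #<= `I_(ncard D * fG ar Sigma)) /\
  (CT D Sigma <->
     weakly_acyclic (@spred_ar (stype P)) (simple_db (lin_db ar D Sigma))
       (simple (lin ar Sigma))).
Proof.
have [finS wfS _] := tgdS; have [_ wfD] := dbD.
rewrite /CT /= chaseE //.
(* The circle is (3) to (2) to (1) to (3). *)
have WA_bound : weakly_acyclic (@spred_ar (stype P))
    (simple_db (lin_db ar D Sigma)) (simple (lin ar Sigma)) ->
    least_chase Sigma (inst_of D) #<= `I_(ncard D * fG ar Sigma).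
  move=> WA; apply: chase_bound => // a t Ca ta.
  exact: (weakly_acyclic_depth ar_gt0 finS wfS wfD guardedS WA Ca).
have bound_fin : least_chase Sigma (inst_of D) #<= `I_(ncard D * fG ar Sigma) ->
    finite_set (least_chase Sigma (inst_of D)).
  by move=> ?; apply/finite_set_leP; eexists; eassumption.
have fin_WA := finite_chase_weakly_acyclic ar_gt0 finS wfS wfD guardedS.
split; split=> //; first by move/fin_WA/WA_bound.
by move/WA_bound/bound_fin.
Qed.
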